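(* Let $p$ be a prime and $(t_n)_{n\ge1}$ a sequence of positive integers with $t_n\le n$. For each $n$ let $\sigma_{n,i}=[t_n+(i-1)]$ for $1\le i\le n-t_n$ and $\sigma_{n,i}=[n]$ for $n-t_n+1\le i\le n$, and let $X_n$ be a Haar-random matrix in $\mathrm{M}_n(\mathbb{Z}_p)$ supported on $\Sigma_n=(\sigma_{n,1},\ldots,\sigma_{n,n})$. If $\lim_{n\to\infty}(t_n-\log_p n)=\infty$, then $\mathrm{cok}(X_n)$ converges to CL.
   Context: $[m]=\{1,\ldots,m\}$. A Haar-random matrix supported on $\Sigma_n$ has $(X_n)_{i,j}=0$ for $i\notin\sigma_{n,j}$ and independent Haar-distributed entries $(X_n)_{i,j}$ for $i\in\sigma_{n,j}$. $\mathrm{cok}(X_n)$ converges to CL means: for every finite abelian $p$-group $H$, $\lim_{n\to\infty}\mathbb{P}(\mathrm{cok}(X_n)\cong H)=\frac{1}{|\mathrm{Aut}(H)|}\prod_{i=1}^\infty(1-p^{-i})$. *)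

(* Defs.v *)
From HB Require Import structures.
From mathcomp Require Import all_boot all_order all_algebra all_fingroup.
From mathcomp Require Import all_solvable.
From mathcomp Require Import ring_quotient.
From mathcomp Require Import all_classical all_reals all_analysis.

Set Implicit Arguments.
Unset Strict Implicit.
Unset Printing Implicit Defensive.

Import Order.TTheory GRing.Theory Num.Theory.
Import numFieldNormedType.Exports.

Local Open Scope classical_set_scope.
Local Open Scope ring_scope.

(* Z_p as the inverse limit of the rings Z/p^k: the k-th component of x is the
   residue of x in {0, ..., p^k - 1}.  The coherence condition at k also forces
   that component to be reduced modulo p^k. *)
Record padic_int (p : nat) := PadicInt {
  residue :> nat -> int;
  residue_coherent : forall k, (residue k.+1 %% (p ^ k)%:Z)%Z = residue k }.

Section PadicIntRing.
Variable p : nat.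
Local Notation Zp := (padic_int p).
Implicit Types x y z : Zp.

Lemma padic_int_ext x y : (forall k, x k = y k) -> x = y.
Proof.
case: x y => [f hf] [g hg] /= fg.
have {}fg : f = g by apply/funext.
by rewrite fg in hf *; congr PadicInt; exact: Prop_irrelevance.
Qed.

HB.instance Definition _ := gen_eqMixin Zp.
HB.instance Definition _ := gen_choiceMixin Zp.

Lemma residue_mod x k : (x k %% (p ^ k)%:Z)%Z = x k.
Proof. by rewrite -(residue_coherent x) modz_mod. Qed.

Lemma modz_mod_pow (m : int) k :
  ((m %% (p ^ k.+1)%:Z)%Z %% (p ^ k)%:Z)%Z = (m %% (p ^ k)%:Z)%Z.
Proof.
rewrite {2}(divz_eq m (p ^ k.+1)%:Z) expnS PoszM mulrA.
by rewrite modzMDl.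
Qed.

Definition padic_of_seq (f : nat -> int)
    (hf : forall k, (f k.+1 = f k %[mod (p ^ k)%:Z])%Z) : Zp.
Proof.
exists (fun k => (f k %% (p ^ k)%:Z)%Z) => k.
by rewrite modz_mod_pow hf.
Defined.

Fact padic_add_subproof x y k :
  (x k.+1 + y k.+1 = x k + y k %[mod (p ^ k)%:Z])%Z.
Proof. by rewrite -modzDm !residue_coherent. Qed.

Fact padic_opp_subproof x k : (- x k.+1 = - x k %[mod (p ^ k)%:Z])%Z.
Proof. by rewrite -modzNm residue_coherent. Qed.

Fact padic_mul_subproof x y k :
  (x k.+1 * y k.+1 = x k * y k %[mod (p ^ k)%:Z])%Z.
Proof. by rewrite -modzMm !residue_coherent. Qed.

Fact padic_cst_subproof (m : int) k : (m = m %[mod (p ^ k)%:Z])%Z.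
Proof. by []. Qed.

Definition padic_zero : Zp := padic_of_seq (padic_cst_subproof 0).
Definition padic_one : Zp := padic_of_seq (padic_cst_subproof 1).
Definition padic_add x y : Zp := padic_of_seq (padic_add_subproof x y).
Definition padic_opp x : Zp := padic_of_seq (padic_opp_subproof x).
Definition padic_mul x y : Zp := padic_of_seq (padic_mul_subproof x y).

Fact padic_addA : associative padic_add.
Proof.
by move=> x y z; apply: padic_int_ext => k /=; rewrite modzDml modzDmr addrA.
Qed.

Fact padic_addC : commutative padic_add.
Proof. by move=> x y; apply: padic_int_ext => k /=; rewrite addrC. Qed.

Fact padic_add0 : left_id padic_zero padic_add.
Proof.
by move=> x; apply: padic_int_ext => k /=; rewrite modzDml add0r residue_mod.
Qed.

Fact padic_addN : left_inverse padic_zero padic_opp padic_add.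
Proof.
by move=> x; apply: padic_int_ext => k /=; rewrite modzDml addNr.
Qed.

HB.instance Definition _ := GRing.isZmodule.Build Zp
  padic_addA padic_addC padic_add0 padic_addN.

Fact padic_mulA : associative padic_mul.
Proof.
by move=> x y z; apply: padic_int_ext => k /=; rewrite modzMml modzMmr mulrA.
Qed.

Fact padic_mulC : commutative padic_mul.
Proof. by move=> x y; apply: padic_int_ext => k /=; rewrite mulrC. Qed.

Fact padic_mul1 : left_id padic_one padic_mul.
Proof.
by move=> x; apply: padic_int_ext => k /=; rewrite modzMml mul1r residue_mod.
Qed.

Fact padic_mulDl : left_distributive padic_mul +%R.
Proof.
move=> x y z; apply: padic_int_ext => k /=.
by rewrite modzMml modzDm mulrDl.
Qed.

HB.instance Definition _ := GRing.Zmodule_isComPzRing.Build Zp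
  padic_mulA padic_mulC padic_mul1 padic_mulDl.

HB.instance Definition _ := isPointed.Build Zp padic_zero.

(* p-adic topology: [set y | y k = x k] is the coset x + p^k Z_p. *)
Definition padic_open : set_system Zp :=
  [set U | forall x, U x -> exists k, [set y : Zp | y k = x k] `<=` U].

Fact padic_openT : padic_open setT.
Proof. by move=> x _; exists 0%N. Qed.

Lemma residue_eq_le x y k l : (k <= l)%N -> x l = y l -> x k = y k.
Proof.
move=> /subnK <-; elim: (l - k)%N => //= m IH; rewrite addSn => e.
by apply: IH; rewrite -(residue_coherent x) -(residue_coherent y) e.
Qed.

Fact padic_openI : setI_closed padic_open.
Proof.
move=> U V hU hV x [Ux Vx].
have [k kU] := hU x Ux; have [l lV] := hV x Vx.
exists (maxn k l) => y /= yx; split.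
  by apply: kU; apply: residue_eq_le yx; exact: leq_maxl.
by apply: lV; apply: residue_eq_le yx; exact: leq_maxr.
Qed.

Fact padic_open_bigU (I : Type) (f : I -> set Zp) :
  (forall i, padic_open (f i)) -> padic_open (\bigcup_i f i).
Proof.
move=> hf x [i _ fx]; have [k kf] := hf i x fx.
by exists k => y /kf fy; exists i.
Qed.

HB.instance Definition _ := isOpenTopological.Build Zp
  padic_openT padic_openI padic_open_bigU.

End PadicIntRing.

(* Z_p with its Borel sigma-algebra. *)
Definition padic_borel (p : nat) := g_sigma_algebraType (@open (padic_int p)).
HB.instance Definition _ p := Measurable.on (padic_borel p).

(* The normalized Haar measure of the compact group (Z_p, +), as the
   translation-invariant Borel probability measure. *)
Definition is_haar_probability (R : realType) (p : nat)
    (mu : set (padic_borel p) -> \bar R) : Prop :=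
  mu setT = 1%E /\
  forall (a : padic_int p) (B : set (padic_borel p)), measurable B ->
    mu [set a + b | b in (B : set (padic_int p))] = mu B.

Definition haar_distributed (d : measure_display) (T : measurableType d)
    (R : realType) (P : probability T R) (p : nat) (Y : T -> padic_borel p) :
    Prop :=
  measurable_fun setT Y /\ is_haar_probability (pushforward P Y).

Definition mutually_independent (d d' : measure_display)
    (T : measurableType d) (U : measurableType d') (R : realType)
    (P : probability T R) (I : finType) (A : {set I}) (Y : I -> T -> U) : Prop :=
  forall (J : {set I}) (B : I -> set U), J \subset A ->
    (forall i, measurable (B i)) ->
    P (\bigcap_(i in [set` J]) (Y i @^-1` B i)) =
    (\prod_(i in J) P (Y i @^-1` B i))%E.

(* S j is the set of rows allowed to be nonzero in column j. *)
Definition haar_random_supported (d : measure_display) (T : measurableType d)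
    (R : realType) (P : probability T R) (p n : nat) (S : 'I_n -> {set 'I_n})
    (X : T -> 'M[padic_int p]_n) : Prop :=
  let entry (ij : 'I_n * 'I_n) (w : T) : padic_borel p := X w ij.1 ij.2 in
  [/\ forall w i j, i \notin S j -> X w i j = 0,
      forall i j, i \in S j -> haar_distributed P (entry (i, j)) &
      mutually_independent P [set ij : 'I_n * 'I_n | ij.1 \in S ij.2]%SET entry].

(* The family (sigma_1, ..., sigma_n): with 0-based rows and columns, [m] is
   [set i | i < m] and column j is the (j + 1)-st. *)
Definition staircase (t n : nat) (j : 'I_n) : {set 'I_n} :=
  if (j < n - t)%N then [set i : 'I_n | (i < t + j)%N]%SET else [set: 'I_n]%SET.

Section Cokernel.
Variables (p n : nat) (X : 'M[padic_int p]_n).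

Definition mx_image : {pred 'cV[padic_int p]_n} :=
  fun v => `[< exists u : 'cV[padic_int p]_n, v = X *m u >].

Fact mx_image_zmod_closed : zmod_closed mx_image.
Proof.
split; first by apply/asboolP; exists 0; rewrite mulmx0.
move=> _ _ /asboolP[u ->] /asboolP[v ->].
by apply/asboolP; exists (u - v); rewrite mulmxBr.
Qed.

HB.instance Definition _ :=
  GRing.isZmodClosed.Build 'cV[padic_int p]_n mx_image mx_image_zmod_closed.

Definition cok : zmodType := Quotient.quot mx_image.

End Cokernel.

Definition isog_zmod (V : zmodType) (gT : finGroupType) (H : {group gT}) :
    Prop :=
  exists f : V -> gT,
    [/\ {morph f : x y / x + y >-> (x * y)%g}, injective f & range f = [set` H]].

Definition log_base (R : realType) (b x : R) : R := ln x / ln b.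

Definition infinite_prod (R : realType) (u : nat -> R) : R :=
  limn (fun N => \prod_(1 <= i < N.+1) u i).

Definition converges_to_CL (R : realType) (p : nat) (d : nat -> measure_display)
    (T : forall n, measurableType (d n)) (P : forall n, probability (T n) R)
    (X : forall n, T n -> 'M[padic_int p]_n) : Prop :=
  forall (gT : finGroupType) (H : {group gT}), abelian H -> (p.-group H)%g ->
    P n [set w | isog_zmod (cok (X n w)) H] @[n --> \oo] -->
    (#|Aut H|%:R^-1 * infinite_prod (fun i => 1 - p%:R ^- i) : R)%:E.

(* Main.v *)
(* Fix H of order p^m and work modulo q = p^(m+1), which by Nakayama's lemma
   suffices to recognise cok(X) = H.  For a surjection f : (Z/q)^n -> H with
   kernel N, the columns of X generate N iff they generate the n-dimensional
   F_p-space N / pN, and column j is confined to N_j = N :&: V_j, where V_j is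
   spanned by the first min(t + j, n) coordinates.  If f maps V_0 onto H, then
   #|N_j| = #|V_j| / #|H| and the images of the N_j in N / pN form a flag of
   dimensions min(t + j, n), so the columns generate N with probability exactly
   #|H|^-n * (1 - p^-t)^(n-t) * prod_(1 <= i <= t) (1 - p^-i).
   Summing over f counts every presentation #|Aut H| times.  If f does not map
   V_0 onto H, composing f with H -> H / M for a maximal subgroup M gives a
   nonzero map to a group of order p that kills V_0 and all columns; a union
   bound over the first coordinate on which such a map is nonzero makes this
   event O(n p^(1-t)).  The growth hypothesis says that n p^-t tends to 0. *)

From HB Require Import structures.
From mathcomp Require Import all_boot all_order all_algebra all_fingroup.
From mathcomp Require Import all_solvable.
From mathcomp Require Import zify ring lra.

Set Implicit Arguments.
Unset Strict Implicit.
Unset Printing Implicit Defensive.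

(** * Counting generating families of kernels *)

Module KernelCount.
Import GroupScope.

Section ConsFamily.
Variable T : finType.

Definition fcons n (x : T) (c : {ffun 'I_n -> T}) : {ffun 'I_n.+1 -> T} :=
  [ffun i => oapp c x (unlift ord0 i)].

Lemma fcons0 n x (c : {ffun 'I_n -> T}) : fcons x c ord0 = x.
Proof. by rewrite ffunE unlift_none. Qed.

Lemma fconsS n x (c : {ffun 'I_n -> T}) i : fcons x c (lift ord0 i) = c i.
Proof. by rewrite ffunE liftK. Qed.

Lemma card_fcons n (Q : pred {ffun 'I_n.+1 -> T}) :
  #|[set c | Q c]| = (\sum_x #|[set c | Q (fcons x c)]|)%N.
Proof.
pose u (xc : T * {ffun 'I_n -> T}) := fcons xc.1 xc.2.
pose v (c : {ffun 'I_n.+1 -> T}) := (c ord0, [ffun i => c (lift ord0 i)]).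
have uK : cancel u v.
  case=> x c; rewrite /u /v /= fcons0; congr (_, _); apply/ffunP => i.
  by rewrite ffunE fconsS.
have vK : cancel v u.
  move=> c; apply/ffunP => i; rewrite /u /v /=.
  by case: (unliftP ord0 i) => [j|] ->; rewrite ?fcons0 // fconsS ffunE.
rewrite -sum1_card (reindex u); last by exists v => x _.
under [RHS]eq_bigr do rewrite -sum1_card.
by rewrite pair_big_dep; apply: eq_bigl => -[x c]; rewrite !inE.
Qed.

Lemma imset_fcons n x (c : {ffun 'I_n -> T}) :
  fcons x c @: setT = x |: c @: setT.
Proof.
apply/setP => y; rewrite !inE; apply/imsetP/orP => [[i _ ->]|[/eqP->|]].
- case: (unliftP ord0 i) => [j|] ->; rewrite ?fcons0 ?eqxx; last by left.
  by right; rewrite fconsS imset_f.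
- by exists ord0; rewrite ?fcons0.
- by case/imsetP=> i _ ->; exists (lift ord0 i); rewrite ?fconsS.
Qed.

End ConsFamily.

(** * Generating families confined to a flag of subgroups *)

Section FlagGeneration.
Variables (gT : finGroupType) (p : nat) (N : {group gT}).
Hypotheses (p_pr : prime p) (abN : abelian N).

Lemma joing_fcons n x (c : {ffun 'I_n -> gT}) (D : {group gT}) :
  fcons x c @: setT <*> D = c @: setT <*> (<[x]> <*> D).
Proof.
by rewrite imset_fcons joing_idl joing_idr !joingE setUC setUCA setUA setUC setUCA.
Qed.

(** Modulo [D] the element [x] is nontrivial and killed by [p], so it generates a subgroup of order
    [p]. *)
Lemma card_joing_cycle (D : {group gT}) x :
    D \subset N -> x \in N -> x ^+ p \in D -> x \notin D ->
  #|<[x]> <*> D| = (p * #|D|)%N.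
Proof.
move=> sDN Nx Dxp notDx.
have nDN : N \subset 'N(D) by rewrite cents_norm // (centsS sDN).
have nDx : x \in 'N(D) by apply: (subsetP nDN).
have sxN : <[x]> \subset 'N(D) by rewrite cycle_subG.
rewrite -(LagrangeI (<[x]> <*> D) D) (setIidPr (joing_subr _ _)) mulnC.
congr (_ * _)%N; rewrite -card_quotient; last by rewrite join_subG sxN normG.
rewrite quotientYidr // quotient_cycle //.
apply: nt_prime_order => //; first by rewrite -morphX //; apply: coset_id.
by apply: contra notDx => /eqP /coset_idr; apply.
Qed.

(** Each adjoined vector multiplies the order by 1 or by [p]. Equality therefore means that every
    vector is new when its turn comes, the group analogue of linear independence modulo [D]. *)
Lemma card_joing_family_le n (c : {ffun 'I_n -> gT}) (D : {group gT}) :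
    D \subset N -> (forall x, x \in N -> x ^+ p \in D) ->
    (forall j, c j \in N) ->
  (#|c @: setT <*> D| <= p ^ n * #|D|)%N.
Proof.
elim: n c D => [|n IHn] c D sDN Dp Nc.
  have -> : c @: setT = set0 by apply/setP => x; rewrite inE; apply/imsetP => -[[]].
  by rewrite joingE set0U genGid mul1n.
have -> : c = fcons (c ord0) [ffun i => c (lift ord0 i)].
  apply/ffunP => i.
  by case: (unliftP ord0 i) => [j|] ->; rewrite ?fcons0 // fconsS ffunE.
rewrite joing_fcons; set x := c ord0.
have Nx : x \in N by exact: Nc.
apply: leq_trans (IHn _ [group of <[x]> <*> D] _ _ _) _ => /=.
- by rewrite join_subG cycle_subG Nx.
- by move=> y /Dp; apply: subsetP; apply: joing_subr.
- by move=> j; rewrite ffunE.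
rewrite expnSr -mulnA leq_mul2l; apply/orP; right.
have [Dx|notDx] := boolP (x \in D); last by rewrite card_joing_cycle ?Dp.
have /joing_idPr -> : <[x]> \subset D by rewrite cycle_subG.
by rewrite leq_pmull ?prime_gt0.
Qed.

(* The first vector is peeled off and absorbed into D; this replaces each
   #|Ns j :&: D| by p times itself. *)
Lemma card_flag_generators n (Ns : nat -> {group gT}) (D : {group gT}) :
    (forall j, Ns j \subset Ns j.+1) -> (forall j, Ns j \subset N) ->
    D \subset N -> (forall x, x \in N -> x ^+ p \in D) ->
  #|[set c : {ffun 'I_n -> gT} | [forall j, c j \in Ns j] &&
                                 (#|c @: setT <*> D| == p ^ n * #|D|)%N]|
  = (\prod_(j < n) (#|Ns j| - p ^ j * #|Ns j :&: D|))%N.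
Proof.
elim: n Ns D => [|n IHn] Ns D sNsS sNsN sDN Dp.
  have c0 : #|{ffun 'I_0 -> gT}| = 1%N by rewrite card_ffun card_ord.
  rewrite big_ord0 -[RHS]c0; apply: eq_card => c; rewrite !inE; apply/andP.
  split; first by apply/forallP => -[].
  have -> : c @: setT = set0 by apply/setP => x; rewrite inE; apply/imsetP => -[[]].
  by rewrite joingE set0U genGid mul1n.
rewrite card_fcons big_ord_recl /= mul1n.
(* A first vector outside [Ns 0] is not allowed, and one inside [D] leaves only [n] vectors to
   supply the factor [p ^ n.+1]. Only [Ns 0 :\: D] contributes, which yields the factor at
   [j = 0]. *)
rewrite (bigID (mem (Ns 0%N :\: D))) /= [X in (_ + X)%N]big1 ?addn0; last first.
  move=> x xP; apply/eqP; rewrite cards_eq0; apply/eqP/setP => c; rewrite !inE.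
  apply/negbTE; apply: contra xP => /andP[/forallP cN].
  have Nx := cN ord0; rewrite fcons0 /= in Nx.
  rewrite in_setD Nx andbT; apply: contraL => Dx.
  rewrite joing_fcons.
  have /joing_idPr -> : <[x]> \subset D by rewrite cycle_subG.
  rewrite neq_ltn (leq_ltn_trans (card_joing_family_le sDN Dp _)) //.
    move=> j; have := cN (lift ord0 j); rewrite fconsS; exact/subsetP.
  by rewrite ltn_pmul2r ?cardG_gt0 // ltn_exp2l ?prime_gt1.
rewrite -cardsD (eq_bigr (fun=> (\prod_(i < n) (#|Ns (bump 0 i)| -
   p ^ bump 0 i * #|Ns (bump 0 i) :&: D|))%N)); first by rewrite sum_nat_const.
move=> x; rewrite in_setD => /andP[notDx Nx].
have sN0 j : Ns 0%N \subset Ns j by elim: j => // j /subset_trans; apply.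
have NNx j : x \in Ns j by apply: (subsetP (sN0 j)).
have NxN : x \in N by apply: (subsetP (sNsN 0%N)).
have cxN (A : {group gT}) : A \subset N -> commute <[x]> A.
  by move=> sAN; apply: centC; rewrite cycle_subG (subsetP (centsS sAN abN)).
pose D' := [group of <[x]> <*> D].
have -> : (\prod_(i < n) (#|Ns (bump 0 i)| - p ^ bump 0 i * #|Ns (bump 0 i) :&: D|) =
   \prod_(i < n) (#|Ns i.+1| - p ^ i * #|Ns i.+1 :&: D'|))%N.
  apply: eq_bigr => i _; rewrite /bump /= add1n; congr (_ - _)%N.
  rewrite expnSr -mulnA; congr (_ * _)%N; rewrite /D' /=.
  (* Since [x] lies in every [Ns j], Dedekind's modular law identifies the intersection of [Ns i.+1]
     with [<[x]> <*> D] as [<[x]> <*> (Ns i.+1 :&: D)]. *)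
  rewrite -(@card_joing_cycle (Ns i.+1 :&: D)%G x) //.
  - congr #|pred_of_set _|; rewrite !comm_joingE.
    + by rewrite [RHS]setIC -group_modl ?cycle_subG // setIC.
    + by apply: cxN.
    + by apply: cxN; rewrite subIset ?sNsN.
  - by rewrite subIset ?sNsN.
  - by rewrite inE groupX //= Dp.
  - by rewrite inE NNx.
rewrite -(IHn (fun j => Ns j.+1)) //; first last.
- by move=> y /Dp; apply: subsetP; apply: joing_subr.
- by rewrite join_subG cycle_subG NxN.
apply: eq_card => c; rewrite !inE joing_fcons; congr (_ && _); last first.
  by rewrite /= card_joing_cycle ?Dp // mulnA -expnSr.
apply/forallP/forallP => cN j.
  by have := cN (lift ord0 j); rewrite fconsS.
by case: (unliftP ord0 j) => [i|] ->; rewrite ?fcons0 // fconsS; apply: cN.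
Qed.

End FlagGeneration.

Lemma prod_morph_in (gT : finGroupType) (G : {group gT}) (I : Type) (r : seq I)
    (a b c : I -> gT) :
    abelian G -> (forall i, a i \in G) -> (forall i, b i \in G) ->
    (forall i, c i = a i * b i) ->
  \prod_(i <- r) c i = \prod_(i <- r) a i * \prod_(i <- r) b i.
Proof.
move=> abG Ga Gb cE; elim: r => [|i r IHr]; first by rewrite !big_nil mulg1.
rewrite !big_cons IHr cE -!mulgA; congr (_ * _); rewrite !mulgA; congr (_ * _).
by apply: (centsP abG) => //; apply: group_prod => j _; apply: Ga.
Qed.

Lemma card_col (T : finType) n (F : 'I_n -> pred T) :
  #|[set v : 'cV[T]_n | [forall i, v i ord0 \in F i]]| = (\prod_(i < n) #|F i|)%N.
Proof.
have <- : #|family F| = (\prod_(i < n) #|F i|)%N.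
  by rewrite card_family foldrE big_map big_enum.
pose u (v : 'cV[T]_n) : {ffun 'I_n -> T} := [ffun i => v i ord0].
have u_inj : injective u.
  move=> v w /ffunP uvw; apply/colP => i; by have := uvw i; rewrite !ffunE.
rewrite -(card_imset _ u_inj); apply: eq_card => f.
apply/imsetP/familyP => [[v + ->] i|Ff].
  by rewrite inE ffunE => /forallP/(_ i).
exists (\col_i f i)%R; last by apply/ffunP => i; rewrite ffunE mxE.
by rewrite inE; apply/forallP => i; rewrite mxE.
Qed.

(** * Homomorphisms from (Z/q)^n and their restriction to coordinate subspaces *)

Section Evaluation.
Variables (gT : finGroupType) (q n : nat).
Local Notation U := 'cV['Z_q]_n.
Implicit Types (h : {ffun 'I_n -> gT}) (v : U).

(* The homomorphism (Z/q)^n -> gT sending the i-th basis vector to h i. *)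
Definition ev h v : gT := \prod_i h i ^+ (v i ord0 : nat).

Definition kerv h : {set U} := [set v | ev h v == 1].

(** This is the span of the first [min(r, n)] basis vectors, written coordinatewise in the shape
    that [card_col] counts. *)
Definition supp (r : nat) : {set U} :=
  [set v : U | [forall i : 'I_n, v i ord0 \in if (i < r)%N then predT else pred1 0%R]].

Lemma suppP r v :
  reflect (forall i : 'I_n, (r <= i)%N -> v i ord0 = 0%R) (v \in supp r).
Proof.
rewrite inE; apply: (iffP forallP) => [vS i ri|vS i].
  by have := vS i; rewrite ltnNge ri /= => /eqP.
by case: ltnP => // /vS ->; rewrite inE.
Qed.

Lemma supp_group_set r : group_set (supp r).
Proof.
apply/group_setP; split; first by apply/suppP => i _; rewrite mxE.
move=> u v /suppP u0 /suppP v0; apply/suppP => i ri.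
by rewrite FinRing.zmodMgE mxE u0 ?v0 ?GRing.addr0.
Qed.
Canonical supp_group r := Group (supp_group_set r).

Lemma supp_leq r s : (r <= s)%N -> supp r \subset supp s.
Proof.
move=> rs; apply/subsetP => v /suppP v0; apply/suppP => i si.
by apply: v0; apply: leq_trans si.
Qed.

Lemma supp_full r : (n <= r)%N -> supp r = setT.
Proof.
move=> nr; apply/setP => v; rewrite in_setT; apply/suppP => i ri.
by have := leq_trans (ltn_ord i) (leq_trans nr ri); rewrite ltnn.
Qed.

Lemma card_ord_lt r : #|[pred i : 'I_n | (i < r)%N]| = minn r n.
Proof.
rewrite -sum1_card big_mkcond /=; elim: n => [|n' IHn].
  by rewrite big_ord0 minn0.
rewrite big_ord_recr /= IHn inE /=; case: ltnP; lia.
Qed.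

Lemma card_family_lt (F : 'I_n -> nat) (a r : nat) :
    (forall i : 'I_n, F i = if (i < r)%N then a else 1%N) ->
  (\prod_i F i = a ^ minn r n)%N.
Proof.
move=> FE; rewrite (eq_bigr _ (fun i _ => FE i)) -big_mkcond /= prod_nat_const.
by rewrite card_ord_lt.
Qed.

Hypothesis q_gt1 : (1 < q)%N.

Lemma card_supp r : #|supp r| = (q ^ minn r n)%N.
Proof.
rewrite card_col; apply: card_family_lt => i.
by case: ifP => _; rewrite ?card1 // card_ord Zp_cast.
Qed.

Variable (H : {group gT}).
Hypotheses (abH : abelian H) (Hq : forall x, x \in H -> x ^+ q = 1).

Section Fixed.
Variable h : {ffun 'I_n -> gT}.
Hypothesis hH : forall i, h i \in H.

(** The exponents are representatives of residues modulo [q]; reducing their sum is harmless because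
    [x ^+ q = 1] on [H]. *)
Lemma evM : {in [set: U] &, {morph ev h : u v / u * v}}.
Proof.
move=> u v _ _; apply: (prod_morph_in _ abH) => i; rewrite ?groupX //.
rewrite FinRing.zmodMgE mxE -expgD -[RHS](expg_mod _ (Hq (hH i))).
by congr (_ ^+ _); rewrite /=; congr (_ %% _); rewrite Zp_cast.
Qed.

Canonical ev_morphism := Morphism evM.

Lemma kervE : kerv h = 'ker (ev h).
Proof. by apply/setP => v; rewrite !inE. Qed.

Lemma kerv_group_set : group_set (kerv h).
Proof. by rewrite kervE groupP. Qed.

Lemma ev_delta i : ev h (delta_mx i ord0) = h i.
Proof.
rewrite /ev; transitivity (\prod_(j | j == i) h j); last by rewrite big_pred1_eq.
rewrite [RHS]big_mkcond; apply: eq_bigr => j _.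
by rewrite mxE eqxx andbT; case: eqP.
Qed.

Lemma ev_in v : ev h v \in H.
Proof. by apply: group_prod => i _; rewrite groupX. Qed.

Lemma ev_supp r : ev h @* supp r = <<[set h i | i : 'I_n & (i < r)%N]>>.
Proof.
apply/eqP; rewrite eqEsubset; apply/andP; split.
  apply/subsetP => _ /morphimP[v _ /suppP v0 ->]; apply: group_prod => i _.
  case: (ltnP i r) => ir; last by rewrite (v0 _ ir) group1.
  by apply: groupX; apply: mem_gen; apply: imset_f; rewrite inE.
rewrite gen_subG; apply/subsetP => _ /imsetP[i + ->]; rewrite inE => ir.
rewrite -(ev_delta i); apply: mem_morphim; rewrite ?in_setT //.
apply/suppP => j rj; rewrite mxE.
by case: eqP => // ji; move: rj; rewrite ji leqNgt ir.
Qed.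

(** First isomorphism theorem for [ev h] restricted to [supp r], whose image is generated by the
    first [r] values of [h]. *)
Lemma card_kerv_supp r :
  (#|kerv h :&: supp r| * #|<<[set h i | i : 'I_n & (i < r)%N]>>| = #|supp r|)%N.
Proof.
by rewrite -ev_supp card_morphim setTI kervE setIC LagrangeI.
Qed.

End Fixed.
End Evaluation.

(** * The p-torsion of (Z/p^(m+1))^n *)

Section Torsion.
Variables (p m n : nat).
Hypothesis p_pr : prime p.
Local Notation q := (p ^ m.+1)%N.
Local Notation U := 'cV['Z_q]_n.

Lemma expS_prime_gt1 : (1 < q)%N.
Proof. by rewrite -(exp1n m.+1) ltn_exp2r ?prime_gt1. Qed.

Lemma p_torsion_dvd (z : 'Z_q) : (z *+ p = 0)%R -> p ^ m %| z.
Proof.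
move=> z0; have : q %| z * p.
  have := congr1 (fun x : 'Z_q => x : nat) z0.
  rewrite -[z in (z *+ p)%R]natr_Zp -GRing.mulrnA.
  by rewrite val_Zp_nat ?expS_prime_gt1 //= => /eqP.
by rewrite [X in X %| _ -> _]expnSr dvdn_pmul2r ?prime_gt0.
Qed.

(** The additive group of ['Z_q] is a nontrivial cyclic p-group, so its subgroup ['Ohm_1] has order
    [p]. *)
Lemma card_p_torsion : #|[pred z : 'Z_q | (z *+ p == 0)%R]| = p.
Proof.
have pgZ : p.-group [set: 'Z_q].
  by rewrite /pgroup cardsT card_ord Zp_cast ?expS_prime_gt1 // pnatX pnat_id.
have cZ : cyclic [set: 'Z_q] by apply/cyclicP; exists 1%R; rewrite -Zp_cycle.
have ntZ : [set: 'Z_q] != 1.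
  by rewrite -cardG_gt1 cardsT card_ord Zp_cast ?expS_prime_gt1.
rewrite -[RHS](Ohm1_cyclic_pgroup_prime cZ pgZ ntZ) (OhmEabelian pgZ).
  by rewrite setTI expn1; apply: eq_card => z; rewrite !inE FinRing.zmodXgE.
exact: abelianS (Ohm_sub _ _) (cyclic_abelian cZ).
Qed.

Lemma card_supp_torsion r :
  #|[set v : U | v \in supp _ _ r & v ^+ p == 1]| = (p ^ minn r n)%N.
Proof.
pose F (i : 'I_n) : pred 'Z_q :=
  if (i < r)%N then [pred z | (z *+ p == 0)%R] else pred1 0%R.
rewrite -(@card_family_lt n (fun i => #|F i|) p r); last first.
  by move=> i; rewrite /F; case: ifP => _; rewrite ?card_p_torsion ?card1.
rewrite -card_col; apply: eq_card => v; rewrite !inE FinRing.zmodXgE.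
apply/andP/forallP => [[/forallP vS /eqP vp] i|vF].
  have := vS i; rewrite /F; case: ifP => // _ _; rewrite inE.
  by apply/eqP; have := congr1 (fun w : U => w i ord0) vp; rewrite mulmxnE mxE.
split; first by apply/forallP => i; have := vF i; rewrite /F; case: ifP.
apply/eqP/colP => i; rewrite mulmxnE mxE.
have := vF i; rewrite /F; case: ifP => _ /eqP //= ->.
by rewrite GRing.mul0rn.
Qed.

End Torsion.

(** * Families of columns that generate a given kernel *)

Section KernelGeneration.
Variables (p m n : nat) (gT : finGroupType) (H : {group gT}).
Local Notation q := (p ^ m.+1)%N.
Local Notation U := 'cV['Z_q]_n.
Hypotheses (p_pr : prime p) (abH : abelian H).
Hypothesis Hpm : forall x, x \in H -> x ^+ (p ^ m) = 1.

Lemma exp_q x : x \in H -> x ^+ q = 1.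
Proof. by move=> Hx; rewrite expnSr expgM Hpm // expg1n. Qed.

Variable h : {ffun 'I_n -> gT}.
Hypothesis hH : forall i, h i \in H.

Local Notation N := (Group (kerv_group_set (expS_prime_gt1 m p_pr) abH exp_q hH)).

(** The coordinates of a p-torsion vector are divisible by [p ^ m], which kills [H]. This uses the
    extra power of [p] in the modulus and ensures that the kernel has full rank [n]. *)
Lemma torsion_kerv (v : U) : v ^+ p = 1 -> v \in kerv q h.
Proof.
move=> vp; rewrite inE /ev big1 // => i _.
have /dvdnP[a ->] : p ^ m %| v i ord0.
  apply: p_torsion_dvd => //; have := congr1 (fun w : U => w i ord0) vp.
  by rewrite FinRing.zmodXgE mulmxnE mxE.
by rewrite mulnC expgM Hpm // expg1n.
Qed.

Lemma pgroup_col (G : {group U}) : p.-group G.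
Proof.
apply: (pgroupS (subsetT G)).
have := card_supp n (expS_prime_gt1 m p_pr) n; rewrite supp_full // => cardU.
by rewrite /pgroup [#|_|]cardU !pnatX pnat_id.
Qed.

Let Ns r := (N :&: supp_group q n r)%G.

(** In an abelian p-group the orders of ['Ohm_1] and ['Mho^1] multiply to the order of the group,
    and by [torsion_kerv] the ['Ohm_1] of [Ns r] is the whole p-torsion of [supp r]. Hence [Ns r]
    has rank [min(r, n)]. *)
Lemma card_Mho1_kerv_supp r : (p ^ minn r n * #|'Mho^1(Ns r)|)%N = #|Ns r|.
Proof.
rewrite -(mul_card_Ohm_Mho_abelian 1 (FinRing.zmod_abelian (Ns r))).
rewrite (OhmEabelian (pgroup_col _) (FinRing.zmod_abelian _)) expn1.
congr (_ * _)%N; rewrite -(card_supp_torsion m n p_pr r); apply: eq_card => v.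
rewrite !inE /= -andbA; apply/idP/and3P => [/andP[vS vp]|[_ -> ->]] //; split=> //.
by have := torsion_kerv (eqP vp); rewrite inE.
Qed.

(** This says that [Ns r] modulo its p-th multiples embeds into [N] modulo those of [N], so that the
    flag keeps the expected dimensions. *)
Lemma Mho1_kerv_supp r : 'Mho^1(N) :&: supp q n r = 'Mho^1(Ns r).
Proof.
rewrite !(MhoEabelian 1 (pgroup_col _) (FinRing.zmod_abelian _)) expn1.
apply/setP => v; rewrite inE; apply/andP/imsetP => [[]|[u]].
  case/imsetP => u Nu -> /suppP uS.
  (* Truncating [u] does not change [p u], which is supported on the first [r] coordinates. The
     truncation stays in the kernel because it differs from [u] by p-torsion. *)
  pose w : U := (\col_i if (i < r)%N then u i ord0 else 0)%R.
  have wS : w \in supp q n r by apply/suppP => i; rewrite mxE ltnNge => ->.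
  have wu : u ^+ p = w ^+ p.
    apply/colP => i; move: (uS i); rewrite !FinRing.zmodXgE !mulmxnE mxE.
    by case: ltnP => // _ ->; rewrite // GRing.mul0rn.
  exists w => //; rewrite inE wS andbT -(groupMl _ (groupVr Nu)).
  apply: torsion_kerv.
  by rewrite (expgMn _ (centsP (FinRing.zmod_abelian setT) _ _ _ _)) ?in_setT //
     expgVn wu mulVg.
by rewrite inE => /andP[Nu uS] ->; split; [apply: imset_f|apply: groupX].
Qed.

(** Burnside's basis theorem: generating [N] means generating it modulo the Frattini subgroup
    ['Mho^1(N)], of index [p ^ n]. The flag count then applies with [D = 'Mho^1(N)]. *)
Lemma card_generators_kerv t :
  #|[set c : {ffun 'I_n -> U} | [forall j : 'I_n, c j \in supp q n (t + j)] &
                                 <<c @: setT>> == kerv q h]|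
  = (\prod_(j < n) (#|kerv q h :&: supp q n (t + j)|
                    - p ^ j * #|'Mho^1(Ns (t + j))|))%N.
Proof.
pose D := 'Mho^1(N)%G.
have sDN : D \subset N by apply: Mho_sub.
have cardD : #|N| = (p ^ n * #|D|)%N.
  have := card_Mho1_kerv_supp n; rewrite minnn -Mho1_kerv_supp /= supp_full //.
  by rewrite !setIT => ->.
have DNs r : Ns r :&: D = 'Mho^1(Ns r).
  by rewrite -Mho1_kerv_supp /= setIAC (setIidPr sDN).
rewrite -(eq_bigr _ (fun (j : 'I_n) _ => congr1
  (fun A : {set U} => #|Ns (t + j)| - p ^ j * #|A|)%N (DNs (t + j)%N))).
rewrite -(@card_flag_generators _ p N p_pr (FinRing.zmod_abelian _) n
            (fun j => Ns (t + j)) D) //.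
- apply: eq_card => c; rewrite !inE; apply/andP/andP => -[/forallP cS].
    move/eqP => cN; split.
      apply/forallP => j; rewrite in_setI cS andbT.
      by change (c j \in kerv q h); rewrite -cN mem_gen ?imset_f.
    by rewrite -joing_idl cN (joing_idPl sDN) -cardD.
  move/eqP => cD; have cN j : c j \in N by have := cS j; rewrite in_setI => /andP[].
  split; first by apply/forallP => j; have := cS j; rewrite in_setI => /andP[].
  (* The Frattini subgroup consists of non-generators, so it may be dropped from a generating
     set. *)
  apply/eqP; change (<<c @: setT>> = N); apply: Phi_nongen.
  rewrite (Phi_Mho (pgroup_col _) (FinRing.zmod_abelian _)) joingC.
  apply/eqP; rewrite eqEcard -[#|N|]/(#|N|) cardD cD leqnn andbT join_subG sDN andbT.
  by apply/subsetP => _ /imsetP[j _ ->].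
- by move=> j; rewrite setIS // supp_leq // addnS.
- by move=> j; rewrite subsetIl.
- move=> x Nx; suff: x ^+ p \in 'Mho^1(N) by [].
  rewrite (MhoEabelian 1 (pgroup_col _) (FinRing.zmod_abelian _)).
  by rewrite expn1; apply: imset_f.
Qed.

Variable t : nat.
Hypothesis h_gen : <<[set h i | i : 'I_n & (i < t)%N]>> = H.

Import GRing.Theory Num.Theory.
Local Open Scope ring_scope.

Lemma prefix_gen_eq r : (t <= r)%N -> <<[set h i | i : 'I_n & (i < r)%N]>>%g = H.
Proof.
move=> tr; apply/eqP; rewrite eqEsubset -{2}h_gen gen_subG genS ?andbT.
  by apply/subsetP => _ /imsetP[i _ ->].
apply: imsetS; apply/subsetP => i; rewrite !inE => it.
exact: leq_trans it tr.
Qed.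

(** As the first [t] values of [h] already generate [H], every [N_j] has index [#|H|] in
    [supp q n (t + j)]. The factor at [j] is [#|N_j|] times [1 - p^(j - min(t + j, n))]. *)
Lemma proportion_generators_kerv (F : numFieldType) :
  #|[set c : {ffun 'I_n -> U} | [forall j : 'I_n, c j \in supp q n (t + j)] &
                                 <<c @: setT>>%g == kerv q h]|%:R
  = (\prod_(j < n) #|supp q n (t + j)|)%:R * #|H|%:R ^- n
    * \prod_(j < n) (1 - p%:R ^+ j / p%:R ^+ minn (t + j) n) :> F.
Proof.
rewrite card_generators_kerv !natr_prod.
rewrite -[n in _ ^- n]card_ord -[_ ^- _]exprVn -prodr_const -!big_split /=.
have p0 : p%:R != 0 :> F by rewrite pnatr_eq0 -lt0n prime_gt0.
apply: eq_bigr => j _.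
have H0 : #|H|%:R != 0 :> F by rewrite pnatr_eq0 -lt0n cardG_gt0.
have := card_kerv_supp (expS_prime_gt1 m p_pr) abH exp_q hH (t + j).
rewrite prefix_gen_eq ?leq_addr // => <-.
have <- : (p ^ minn (t + j) n * #|'Mho^1(Ns (t + j))|)%N
    = #|kerv q h :&: supp q n (t + j)| by apply: card_Mho1_kerv_supp.
(* This keeps the natural-number subtraction from truncating. *)
have jd : (j <= minn (t + j) n)%N by rewrite leq_min leq_addl ltnW.
rewrite natrB; last by rewrite leq_mul2r leq_pexp2l ?prime_gt0 ?orbT.
rewrite !natrM !natrX.
by field; rewrite H0 expf_neq0.
Qed.

End KernelGeneration.

Lemma card_ffun_in (I T : finType) (F : I -> {set T}) :
  #|[set c : {ffun I -> T} | [forall i, c i \in F i]]| = (\prod_i #|F i|)%N.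
Proof.
have <- : #|family F| = (\prod_i #|F i|)%N.
  by rewrite card_family foldrE big_map big_enum.
apply: eq_card => c; rewrite !inE; apply/forallP/familyP => cF i.
  exact: cF.
exact: cF.
Qed.

Lemma card_exists_le (I T : finType) (P : I -> pred T) :
  (#|[set c | [exists i, P i c]]| <= \sum_i #|[set c | P i c]|)%N.
Proof.
have -> : [set c | [exists i, P i c]] = \bigcup_i [set c | P i c].
  apply/setP => c; rewrite inE; apply/existsP/bigcupP => [[i Pi]|[i _]].
    by exists i; rewrite ?inE.
  by rewrite inE; exists i.
elim/big_rec2: _ => [|i a b _ ab]; first by rewrite cards0.
by apply: leq_trans (leq_card_setU _ _) _; rewrite leq_add2l.
Qed.

(** * Surjections onto H with a common kernel *)

Section Classes.
Variables (gT : finGroupType) (q n : nat) (H : {group gT}).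
Hypothesis q_gt1 : (1 < q)%N.
Hypotheses (abH : abelian H) (Hq : forall x, x \in H -> x ^+ q = 1).
Local Notation U := 'cV['Z_q]_n.

(** For [r = n] these encode the surjections from [(Z/q)^n] to [H]; for [r = t], those that are
    already onto on the space allowed for the first column. *)
Definition prefix_generates r (h : {ffun 'I_n -> gT}) :=
  [forall i, h i \in H] && (<<[set h i | i : 'I_n & (i < r)%N]>> == H).

Lemma prefix_gen_sub r (h : {ffun 'I_n -> gT}) : (forall i, h i \in H) ->
  <<[set h i | i : 'I_n & (i < r)%N]>> \subset H.
Proof. by move=> hH; rewrite gen_subG; apply/subsetP => _ /imsetP[i _ ->]. Qed.

(** By [card_kerv_supp] the order of the image of [supp r] depends on the kernel alone. *)
Lemma prefix_generates_kerv r (h h' : {ffun 'I_n -> gT}) :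
    (forall i, h' i \in H) -> kerv q h = kerv q h' ->
  prefix_generates r h -> prefix_generates r h'.
Proof.
move=> h'H hh' /andP[/forallP hH /eqP gh]; apply/andP; split; first exact/forallP.
rewrite eqEcard prefix_gen_sub //=.
have := card_kerv_supp q_gt1 abH Hq hH r; rewrite -(card_kerv_supp q_gt1 abH Hq h'H r).
rewrite hh' gh => /eqP; rewrite eqn_pmul2l; first by move/eqP->.
by rewrite -(setIC (supp q n r)) (kervE q_gt1 abH Hq h'H) cardG_gt0.
Qed.

Lemma prefix_generates_full r (h : {ffun 'I_n -> gT}) :
  prefix_generates r h -> prefix_generates n h.
Proof.
move=> /andP[/forallP hH /eqP gh]; apply/andP; split; first exact/forallP.
rewrite eqEsubset prefix_gen_sub //= -{1}gh genS //.
by apply: imsetS; apply/subsetP => i; rewrite !inE => _.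
Qed.

Lemma ev_onto (h : {ffun 'I_n -> gT}) x :
  prefix_generates n h -> x \in H -> exists v : U, x = ev h v.
Proof.
move=> /andP[/forallP hH /eqP gh]; rewrite -gh -(ev_supp q_gt1 abH Hq hH).
by case/morphimP => v _ _ ->; exists v.
Qed.

Lemma ev_morph (rT : finGroupType) (D : {group gT}) (f : {morphism D >-> rT})
    (h : {ffun 'I_n -> gT}) (v : U) :
  (forall i, h i \in D) -> ev [ffun i => f (h i)] v = f (ev h v).
Proof.
move=> hD; rewrite /ev morph_prod => [|i _]; last by rewrite groupX.
by apply: eq_bigr => i _; rewrite ffunE morphX.
Qed.

(** Two surjections onto [H] with the same kernel differ by exactly one automorphism: [Aut H] acts
    on them freely and transitively. *)
Lemma card_same_kerv (h : {ffun 'I_n -> gT}) : prefix_generates n h ->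
  #|[set h' : {ffun 'I_n -> gT} | [forall i, h' i \in H] & kerv q h' == kerv q h]|
  = #|Aut H|.
Proof.
move=> gh; have /andP[/forallP hH _] := gh.
pose comp (a : {perm gT}) : {ffun 'I_n -> gT} := [ffun i => a (h i)].
have ev_comp a (v : U) : a \in Aut H -> ev (comp a) v = a (ev h v).
  by move=> Ha; have := ev_morph (autm_morphism Ha) v hH; rewrite /= autmE.
rewrite -(@card_in_imset _ _ comp (Aut H)); last first.
  move=> a b Ha Hb ab; apply: (eq_Aut Ha Hb) => x Hx.
  by have [v ->] := ev_onto gh Hx; rewrite -!ev_comp // ab.
apply: eq_card => h'; rewrite inE; apply/andP/imsetP => [[/forallP h'H /eqP kh']|[a Ha ->]].
  have gh' : prefix_generates n h' by apply: prefix_generates_kerv gh.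
  pose f := ev_morphism q_gt1 abH Hq hH.
  pose f' := ev_morphism q_gt1 abH Hq h'H.
  have kff' : 'ker f = 'ker f' by rewrite -!kervE.
  have sk : 'ker f \subset 'ker f' by rewrite kff'.
  have imf : f @* setT = H.
    have := ev_supp q_gt1 abH Hq hH n; rewrite supp_full // => ->.
    by case/andP: gh => _ /eqP.
  have imf' : f' @* setT = H.
    have := ev_supp q_gt1 abH Hq h'H n; rewrite supp_full // => ->.
    by case/andP: gh' => _ /eqP.
  have sH : H \subset f @* setT by rewrite imf.
  (* The map sending [ev h v] to [ev h' v], obtained by factoring [f'] through [f]. *)
  pose g := restrm_morphism sH (factm_morphism sk (subxx _)).
  have injg : 'injm g by apply: injm_restrm; apply/injm_factmP; rewrite kff'.
  have img : g @* H = H.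
    by rewrite morphim_restrm setIid -[X in _ @* X]imf morphim_factm imf'.
  exists (aut injg img); first exact: Aut_aut.
  apply/ffunP => i; rewrite ffunE autE // /g /= /restrm.
  rewrite -(ev_delta q h i) -(ev_delta q h' i).
  by rewrite (factmE sk (subxx _)) ?inE.
split; first by apply/forallP => i; rewrite ffunE Aut_closed.
apply/eqP/setP => v; rewrite !inE ev_comp // -(autmE Ha).
by rewrite morph_injm_eq1 ?injm_autm // ev_in.
Qed.

End Classes.

Lemma card_ffun_from (T : finType) n r (A B : {set T}) : (r <= n)%N ->
  #|[set c : {ffun 'I_n -> T} | [forall i : 'I_n, c i \in if (i < r)%N then A else B]]|
  = (#|A| ^ r * #|B| ^ (n - r))%N.
Proof.
move=> rn; rewrite card_ffun_in.
rewrite (bigID (fun i : 'I_n => (i < r)%N)) /=.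
rewrite (eq_bigr (fun=> #|A|)) => [|i ->//].
rewrite [X in (_ * X)%N](eq_bigr (fun=> #|B|)) => [|i /negbTE->//].
rewrite !prod_nat_const; congr (_ ^ _ * _ ^ _)%N.
  by rewrite (card_ord_lt n r); apply/minn_idPl.
have := cardC [pred i : 'I_n | (i < r)%N]; rewrite card_ord_lt card_ord (minn_idPl rn).
move=> E; apply/eqP; rewrite -(eqn_add2l r) subnKC // -[X in _ == X]E.
by rewrite eqn_add2l; apply/eqP; apply: eq_card.
Qed.

(** * Bounds for surjections that are not onto on the first t coordinates *)

Section Nongenerating.
Variables (p n : nat) (gT : finGroupType) (H : {group gT}).
Hypotheses (p_pr : prime p) (pH : p.-group H).

Lemma exists_maximal_lt r (h : {ffun 'I_n -> gT}) : (forall i, h i \in H) ->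
    ~~ prefix_generates H r h ->
  exists2 M : {group gT}, maximal M H & forall i : 'I_n, (i < r)%N -> h i \in M.
Proof.
move=> hH; rewrite negb_and => /orP[/forallPn[i]|gh]; first by rewrite hH.
have [gE|[M maxM sM]] := maximal_exists (prefix_gen_sub r hH).
  by move: gh; rewrite gE eqxx.
exists M => // i ir; apply: (subsetP sM).
by apply: mem_gen; apply: imset_f; rewrite inE.
Qed.

(** A failing [h] sends the first [t] indices into a maximal subgroup of [H], which has at most half
    the elements. The bound sums over all subgroups of [gT], a number independent of [n]. *)
Lemma card_prefix_generates t : (t <= n)%N ->
  (2 ^ t * (#|H| ^ n - #|[set h : {ffun 'I_n -> gT} | prefix_generates H t h]|)
   <= #|{: {group gT}}| * #|H| ^ n)%N.
Proof.
move=> tn; pose A : {set {ffun 'I_n -> gT}} :=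
  [set h : {ffun 'I_n -> gT} | [forall i, h i \in H]].
have cA : #|A| = (#|H| ^ n)%N.
  by rewrite card_ffun_in prod_nat_const card_ord.
set G := [set h | _]; have sGA : G \subset A.
  by apply/subsetP => h; rewrite !inE => /andP[].
rewrite -cA -cardsDS //.
pose P (M : {group gT}) (h : {ffun 'I_n -> gT}) := maximal M H &&
  [forall i : 'I_n, h i \in if (i < t)%N then M : {set gT} else H].
have sAG : A :\: G \subset [set h | [exists M, P M h]].
  apply/subsetP => h; rewrite !inE => /andP[gh /forallP hH].
  have [M maxM hM] := exists_maximal_lt hH gh.
  apply/existsP; exists M; rewrite /P maxM; apply/forallP => i.
  by case: ltnP => [/hM|].
apply: leq_trans (_ : 2 ^ t * \sum_(M : {group gT}) #|[set h | P M h]| <= _)%N.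
  by rewrite leq_mul2l (leq_trans (subset_leq_card sAG)) ?orbT ?card_exists_le.
rewrite big_distrr /= -sum_nat_const leq_sum // => M _; rewrite cA.
have [maxM|nmaxM] := boolP (maximal M H); last first.
  rewrite (_ : [set h | P M h] = set0) ?cards0 ?muln0 //.
  by apply/setP => h; rewrite !inE /P (negbTE nmaxM).
rewrite (_ : [set h | P M h] =
   [set h : {ffun 'I_n -> gT} |
     [forall i : 'I_n, h i \in if (i < t)%N then M : {set gT} else H]]); last first.
  by apply/setP => h; rewrite !inE /P maxM.
rewrite card_ffun_from // mulnA -expnMn.
rewrite -{2}(subnKC tn) expnD leq_mul2r; apply/orP; right.
have ltMH : (2 * #|M| <= #|H|)%N.
  rewrite -(Lagrange (proper_sub (maxgroupp maxM))) mulnC leq_mul2l indexg_gt1.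
  by rewrite (proper_subn (maxgroupp maxM)) orbT.
by case: (posnP t) => [->|t0]; rewrite ?expn0 // leq_exp2r.
Qed.

Variables (q t : nat).
Hypotheses (q_gt1 : (1 < q)%N) (tn : (t <= n)%N).
Local Notation U := 'cV['Z_q]_n.
Local Notation W := (\prod_(j < n) #|supp q n (t + j)|)%N.

(** For [s = t] this counts the columns in which coordinate [r] may be nonzero. *)
Lemma card_ord_gt r s : (s <= r)%N -> (r < n)%N ->
  #|[pred j : 'I_n | (r < s + j)%N]| = (n - r.+1 + s)%N.
Proof.
move=> sr rn; have := cardC [pred j : 'I_n | (j < (r - s).+1)%N].
rewrite card_ord_lt card_ord (minn_idPl _) => [E|]; last by lia.
transitivity (n - (r - s).+1)%N; last by lia.
by rewrite -[X in (X - _)%N]E addKn; apply: eq_card => j; rewrite !inE; lia.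
Qed.

(* In the application C = H / M for a maximal subgroup M, and k is the image
   of h. *)
Lemma card_kerv_first (rT : finGroupType) (C : {group rT}) r
    (k : {ffun 'I_n -> rT}) :
    #|C| = p -> p %| q -> (t <= r)%N -> forall rn : (r < n)%N,
    (forall i, k i \in C) -> (forall i : 'I_n, (i < r)%N -> k i = 1) ->
    k (Ordinal rn) != 1 ->
  (#|[set c : {ffun 'I_n -> U} |
       [forall j : 'I_n, c j \in supp q n (t + j) :&: kerv q k]]|
    * p ^ (n - r.+1 + t) = W)%N.
Proof.
move=> cC pq tr rn kC k1 kr.
have abC : abelian C by rewrite cyclic_abelian // prime_cyclic ?cC.
have Cq x : x \in C -> x ^+ q = 1.
  by move=> Cx; case/dvdnP: pq => a ->; rewrite mulnC expgM -cC expg_cardG // expg1n.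
rewrite card_ffun_in -(card_ord_gt tr rn) -prod_nat_const.
rewrite [X in (_ * X)%N]big_mkcond -big_split /=.
apply: eq_bigr => j _ /=; rewrite setIC.
rewrite -(card_kerv_supp q_gt1 abC Cq kC (t + j)); congr (_ * _)%N.
set K := <<_>>; have sKC : K \subset C.
  by rewrite gen_subG; apply/subsetP => _ /imsetP[i _ ->].
(* The values of [k] available to column [j] generate [C], of prime order, once coordinate [r] is
   included; before that they are all trivial. Only the columns with [r < t + j] lose a factor
   [p]. *)
rewrite inE; case: ltnP => rj.
  rewrite -cC; congr #|pred_of_set _|; apply/eqP; rewrite eq_sym.
  rewrite eqEsubset sKC prime_meetG ?cC //; apply: contraNneq kr => CK1.
  rewrite -in_set1 -[[set 1]]/(1 : {set rT}) -CK1 inE kC mem_gen //.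
  by apply: imset_f; rewrite inE.
suff -> : K = 1 by rewrite cards1.
apply/eqP; rewrite -subG1 gen_subG; apply/subsetP => _ /imsetP[i + ->].
by rewrite !inE => ij; rewrite k1 // (leq_trans ij).
Qed.

(** There are at most [p ^ (n - r)] maps [k], each killing a proportion [p ^ -(n - r.+1 + t)] of the
    families. The product [p ^ (1 - t)] does not depend on [r]. *)
Lemma card_kerv_first_sum (rT : finGroupType) (C : {group rT}) (r : 'I_n) :
    #|C| = p -> p %| q -> (t <= r)%N ->
  (p ^ t * \sum_(k : {ffun 'I_n -> rT} |
       [forall i : 'I_n, k i \in if (i < r)%N then [set 1%g] else (C : {set rT})]
       && (k r != 1%g))
     #|[set c : {ffun 'I_n -> U} |
         [forall j : 'I_n, c j \in supp q n (t + j) :&: kerv q k]]|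
   <= p * W)%N.
Proof.
move=> cC pq tr.
have pn0 : (0 < p ^ (n - r.+1))%N by rewrite expn_gt0 prime_gt0.
rewrite -(leq_pmul2l pn0) mulnA -expnD mulnA -expnSr subnSK //.
rewrite big_distrr /= (eq_bigr (fun=> W)); last first.
  move=> k /andP[/forallP kC kr]; rewrite mulnC.
  have rn : Ordinal (ltn_ord r) = r by apply: val_inj.
  apply: (card_kerv_first cC) => //; last by rewrite rn.
    by move=> i; have := kC i; case: ifP => // _ /set1P ->.
  by move=> i ir; have := kC i; rewrite ir => /set1P.
rewrite sum_nat_const leq_mul2r; apply/orP; right.
have <- : (#|[set 1%g : rT]| ^ r * #|C| ^ (n - r) = p ^ (n - r))%N.
  by rewrite cards1 exp1n mul1n cC.
rewrite -card_ffun_from; last by rewrite ltnW.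
by apply: subset_leq_card; apply/subsetP => k; rewrite !inE => /andP[].
Qed.

(** Union bound over the maximal subgroup [M], the first index [r] with [h r] outside [M], and the
    composite [k] of [h] with [H -> H / M]. The [n] choices of [r] account for the factor [n]. *)
Lemma card_prefix_not_generating : p %| q ->
  (p ^ t * #|[set c : {ffun 'I_n -> U} |
     [forall j : 'I_n, c j \in supp q n (t + j)] &
     [exists h : {ffun 'I_n -> gT},
        [&& prefix_generates H n h, ~~ prefix_generates H t h &
            [forall j, c j \in kerv q h]]]]|
   <= #|{: {group gT}}| * (n * (p * W)))%N.
Proof.
move=> pq; set B := [set c | _ & _].
(* The existentials over [M], [r] and [k] are nested rather than merged because the type of [k]
   depends on [M]; each layer takes one use of [card_exists_le]. *)
pose K (M : {group gT}) (r : 'I_n) (k : {ffun 'I_n -> coset_of M}) :=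
  [forall i : 'I_n, k i \in if (i < r)%N then [set 1] else H / M] && (k r != 1).
pose F (M : {group gT}) (k : {ffun 'I_n -> coset_of M}) (c : {ffun 'I_n -> U}) :=
  [forall j : 'I_n, c j \in supp q n (t + j) :&: kerv q k].
pose P2 (M : {group gT}) (r : 'I_n) (k : {ffun 'I_n -> coset_of M}) c := K M r k && F M k c.
pose P1 (M : {group gT}) (r : 'I_n) c := (t <= r)%N && [exists k, P2 M r k c].
pose P0 (M : {group gT}) c := maximal M H && [exists r, P1 M r c].
have sB : B \subset [set c | [exists M, P0 M c]].
  apply/subsetP => c; rewrite !inE => /andP[/forallP cS].
  case/existsP => h /and3P[/andP[/forallP hH /eqP gh] ngh /forallP ck].
  have [M maxM hM] := exists_maximal_lt hH ngh.
  have /andP[sMH nMH] := p_maximal_normal pH maxM.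
  have hN i : h i \in 'N(M) by apply: (subsetP nMH).
  pose k : {ffun 'I_n -> coset_of M} := [ffun i => coset M (h i)].
  have [i0 i0P] : exists i, h i \notin M.
    apply/existsP; rewrite -negb_forall; apply/negP => /forallP hM'.
    have := proper_subn (maxgroupp maxM); rewrite -gh gen_subG => /negP; apply.
    by apply/subsetP => _ /imsetP[i _ ->].
  (* Such an index exists because [h] generates [H]; the least one is at least [t] because [M]
     contains the first [t] values. *)
  have [r rP rmin] := @arg_minnP _ i0 (fun i => h i \notin M) (fun i : 'I_n => i : nat) i0P.
  apply/existsP; exists M; rewrite /P0 maxM; apply/existsP; exists r.
  apply/andP; split.
    by rewrite leqNgt; apply: contra rP; apply: hM.
  have kE i : (k i == 1) = (h i \in M).
    by rewrite ffunE; apply/eqP/idP => [/coset_idr->//|/coset_id].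
  apply/existsP; exists k; apply/andP; split.
    apply/andP; split; last by rewrite kE.
    apply/forallP => i; case: ltnP => [ir|_]; last by rewrite ffunE mem_quotient.
    apply/set1P/eqP; rewrite kE; apply: contraLR ir => /rmin.
    by rewrite -leqNgt.
  apply/forallP => j; rewrite in_setI cS inE.
  have -> : ev k (c j) = coset M (ev h (c j)) by apply: (ev_morph (coset_morphism M)).
  by have := ck j; rewrite inE => /eqP ->; rewrite morph1 eqxx.
apply: leq_trans (_ : p ^ t * \sum_(M : {group gT}) #|[set c | P0 M c]| <= _)%N.
  by rewrite leq_mul2l (leq_trans (subset_leq_card sB)) ?orbT ?card_exists_le.
rewrite big_distrr /= -sum_nat_const leq_sum // => M _.
have [maxM|nmaxM] := boolP (maximal M H); last first.
  rewrite (_ : [set c | P0 M c] = set0) ?cards0 ?muln0 //.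
  by apply/setP => c; rewrite !inE /P0 (negbTE nmaxM).
have cHM : #|(H / M)%G| = p.
  by rewrite card_quotient ?(p_maximal_index pH) ?normal_norm ?(p_maximal_normal pH).
apply: leq_trans (_ : p ^ t * \sum_r #|[set c | P1 M r c]| <= _)%N.
  rewrite leq_mul2l; apply/orP; right; apply: leq_trans (card_exists_le _).
  by apply: subset_leq_card; apply/subsetP => c; rewrite !inE => /andP[].
rewrite big_distrr /= -[X in (_ <= X * _)%N]card_ord -sum_nat_const leq_sum // => r _.
have [tr|ntr] := boolP (t <= r)%N; last first.
  rewrite (_ : [set c | P1 M r c] = set0) ?cards0 ?muln0 //.
  by apply/setP => c; rewrite !inE /P1 (negbTE ntr).
apply: leq_trans (card_kerv_first_sum cHM pq tr).
rewrite leq_mul2l; apply/orP; right.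
apply: leq_trans (_ : \sum_k #|[set c | P2 M r k c]| <= _)%N.
  apply: leq_trans (card_exists_le _).
  by apply: subset_leq_card; apply/subsetP => c; rewrite !inE => /andP[].
rewrite [leqRHS]big_mkcond leq_sum // => k _.
rewrite -/(K M r k); case Kk: (K M r k).
  by apply: subset_leq_card; apply/subsetP => c; rewrite !inE => /andP[].
by rewrite leqn0 cards_eq0; apply/eqP/setP => c; rewrite !inE /P2 Kk.
Qed.

End Nongenerating.

(** * The number of column families presenting H *)

Section FiniteCount.
Variables (p m n t : nat) (gT : finGroupType) (H : {group gT}).
Hypotheses (p_pr : prime p) (abH : abelian H) (cardH : #|H| = (p ^ m)%N).
Hypothesis tn : (t <= n)%N.
Local Notation q := (p ^ m.+1)%N.
Local Notation U := 'cV['Z_q]_n.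

Definition stair_supported (c : {ffun 'I_n -> U}) :=
  [forall j : 'I_n, c j \in supp q n (t + j)].

Definition presents r (c : {ffun 'I_n -> U}) (h : {ffun 'I_n -> gT}) :=
  prefix_generates H r h && (<<c @: setT>> == kerv q h).

(** The case [r = n] describes the event that the cokernel is [H]; the case [r = t] is the part that
    is counted exactly. *)
Definition presented r :=
  [set c | stair_supported c & [exists h, presents r c h]].

Let q1 := expS_prime_gt1 m p_pr.

Let Hpm x : x \in H -> x ^+ (p ^ m) = 1.
Proof. by move=> Hx; rewrite -cardH expg_cardG. Qed.

Let Hq x : x \in H -> x ^+ q = 1.
Proof. exact: exp_q. Qed.

Lemma card_presents r c : c \in presented r ->
  #|[set h | presents r c h]| = #|Aut H|.
Proof.
rewrite inE => /andP[_ /existsP[h /andP[gh /eqP ck]]].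
have /(card_same_kerv q1 abH Hq) <- := prefix_generates_full gh.
apply: eq_card => h'; rewrite !inE /presents ck.
apply/andP/andP => [[/andP[-> _] /eqP->]//|[/forallP h'H /eqP kh]].
by rewrite kh; split=> //; apply: (prefix_generates_kerv q1 abH Hq) gh.
Qed.

(** Double counting of the pairs [(c, h)] with [presents r c h]: every presented [c] occurs with
    [#|Aut H|] maps [h]. *)
Lemma card_presented r :
  (#|presented r| * #|Aut H|
   = \sum_(h : {ffun 'I_n -> gT} | prefix_generates H r h)
       #|[set c | stair_supported c & <<c @: setT>> == kerv q h]|)%N.
Proof.
rewrite -sum_nat_const (eq_bigr (fun c => \sum_(h | presents r c h) 1)%N); last first.
  by move=> c /card_presents <-; rewrite sum1_card; apply: eq_card => h; rewrite !inE.
rewrite (exchange_big_dep (prefix_generates H r)) /=; last by move=> c h _ /andP[].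
apply: eq_bigr => h gh; rewrite sum1_card; apply: eq_card => c; rewrite !inE.
rewrite unfold_in inE; apply/andP/andP => [[/andP[-> _] /andP[_ ->]]//|[cS ck]].
have ch : presents r c h by rewrite /presents gh.
by split=> //; rewrite cS; apply/existsP; exists h.
Qed.

Local Notation W := (\prod_(j < n) #|supp q n (t + j)|)%N.

Lemma presentedS : presented t \subset presented n.
Proof.
apply/subsetP => c; rewrite !inE => /andP[-> /existsP[h /andP[gh ck]]].
by apply/existsP; exists h; rewrite /presents (prefix_generates_full gh).
Qed.

Lemma card_presentedD :
  (p ^ t * #|presented n :\: presented t| <= #|{: {group gT}}| * (n * (p * W)))%N.
Proof.
have pH : p.-group H by rewrite /pgroup cardH pnatX pnat_id.
apply: leq_trans (card_prefix_not_generating p_pr pH q1 tn (dvdn_exp _ (dvdnn p))) => //.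
rewrite leq_mul2l; apply/orP; right; apply: subset_leq_card.
apply/subsetP => c; rewrite in_setD !inE => /andP[nc /andP[cS /existsP[h /andP[gh ck]]]].
apply/andP; split; first exact: cS.
apply/existsP; exists h; rewrite gh /=; apply/andP; split.
  apply: contra nc => gth; rewrite cS; apply/existsP; exists h.
  by rewrite /presents gth.
by apply/forallP => j; rewrite -(eqP ck) mem_gen // imset_f.
Qed.

Import Order.TTheory GRing.Theory Num.Theory.
Local Open Scope ring_scope.
Variable F : realFieldType.

Definition gen_ratio r : F :=
  #|[set h : {ffun 'I_n -> gT} | prefix_generates H r h]|%:R / #|H|%:R ^+ n.

Lemma gen_ratio_bounds :
  1 - #|{: {group gT}}|%:R / 2 ^+ t <= gen_ratio t <= 1.
Proof.
have H0 : 0 < #|H|%:R ^+ n :> F by rewrite exprn_gt0 // ltr0n cardG_gt0.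
have t0 : 0 < 2 ^+ t :> F by rewrite exprn_gt0.
have le : (#|[set h : {ffun 'I_n -> gT} | prefix_generates H t h]| <= #|H| ^ n)%N.
  have <- : #|[set h : {ffun 'I_n -> gT} | [forall i, h i \in H]]| = (#|H| ^ n)%N.
    by rewrite card_ffun_in prod_nat_const card_ord.
  by apply: subset_leq_card; apply/subsetP => h; rewrite !inE => /andP[].
apply/andP; split; rewrite /gen_ratio; last first.
  by rewrite ler_pdivrMr // mul1r -natrX ler_nat.
rewrite ler_pdivlMr // mulrBl mul1r lerBlDr -lerBlDl.
rewrite mulrAC ler_pdivlMr // mulrC -!natrX -natrB // -!natrM ler_nat.
by apply: card_prefix_generates; rewrite ?cardH.
Qed.

Definition flag_prob : F := \prod_(j < n) (1 - p%:R ^+ j / p%:R ^+ minn (t + j) n).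

Lemma presented_ratio :
  #|presented t|%:R = W%:R * (gen_ratio t / #|Aut H|%:R * flag_prob) :> F.
Proof.
have A0 : #|Aut H|%:R != 0 :> F by rewrite pnatr_eq0 -lt0n cardG_gt0.
apply: (mulIf A0); rewrite -natrM card_presented natr_sum.
rewrite (eq_bigr (fun=> W%:R * #|H|%:R ^- n * flag_prob)); last first.
  move=> h /andP[/forallP hH /eqP gh].
  exact: (proportion_generators_kerv p_pr abH Hpm hH gh F).
have H0 : #|H|%:R != 0 :> F by rewrite pnatr_eq0 -lt0n cardG_gt0.
rewrite sumr_const -mulr_natr /gen_ratio.
have -> : #|(@prefix_generates gT n H t : pred _)| =
    #|[set h : {ffun 'I_n -> gT} | prefix_generates H t h]|.
  by apply: eq_card => h; rewrite [RHS]inE.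
by field; rewrite A0 expf_neq0.
Qed.

(** By [presented_ratio] the subtracted term is the proportion of [presented t], so the error is the
    proportion of [presented n :\: presented t]. *)
Lemma presented_estimate :
  `|#|presented n|%:R / W%:R - gen_ratio t / #|Aut H|%:R * flag_prob|
   <= #|{: {group gT}}|%:R * (n%:R * p%:R / p%:R ^+ t) :> F.
Proof.
have W0 : 0 < W%:R :> F.
  rewrite ltr0n; apply: prodn_gt0 => j; apply: cardG_gt0.
have p0 : 0 < p%:R ^+ t :> F by rewrite exprn_gt0 // ltr0n prime_gt0.
have -> : gen_ratio t / #|Aut H|%:R * flag_prob = #|presented t|%:R / W%:R.
  by rewrite presented_ratio [RHS]mulrC mulKf ?gt_eqF.
rewrite -mulrBl -natrB ?subset_leq_card ?presentedS // -cardsDS ?presentedS //.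
rewrite ger0_norm; last by rewrite divr_ge0 // ltW.
rewrite ler_pdivrMr // !mulrA mulrAC ler_pdivlMr // -natrX -!natrM ler_nat mulnC.
by apply: leq_trans card_presentedD _; rewrite !mulnA.
Qed.

End FiniteCount.

End KernelCount.

Require Import Defs.
From mathcomp Require Import ring_quotient.
From mathcomp Require Import all_classical all_reals all_analysis.

Import KernelCount.
Import Order.TTheory GRing.Theory Num.Theory.
Import numFieldNormedType.Exports.

Local Open Scope classical_set_scope.
Local Open Scope ring_scope.

(** * Arithmetic of p-adic matrices *)

Section PadicArithmetic.
Variable p : nat.
Local Notation Zp := (padic_int p).
Implicit Types x y : Zp.

Lemma residueD x y k : (x + y) k = ((x k + y k)%R %% (p ^ k)%:Z)%Z.
Proof. by []. Qed.

Lemma residueM x y k : (x * y) k = ((x k * y k)%R %% (p ^ k)%:Z)%Z.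
Proof. by []. Qed.

Lemma residue0 k : (0 : Zp) k = 0.
Proof. exact: mod0z. Qed.

Lemma residueMn x a k : (x *+ a) k = ((x k *+ a)%R %% (p ^ k)%:Z)%Z.
Proof.
elim: a => [|a IHa]; first by rewrite !mulr0n residue0 mod0z.
by rewrite !mulrS residueD IHa modzDmr.
Qed.

Lemma residue_pow x k : (x *+ (p ^ k)) k = 0.
Proof. by rewrite residueMn -mulr_natr natz modzMl. Qed.

Hypothesis p_gt0 : (0 < p)%N.

Lemma pow_neq0 k : (p ^ k)%:Z != 0.
Proof. by rewrite eqz_nat expn_eq0 negb_and -lt0n p_gt0. Qed.

Lemma residue_ge0 x k : 0 <= x k.
Proof. by rewrite -(residue_mod x) modz_ge0 ?pow_neq0. Qed.

Lemma residue_lt x k : x k < (p ^ k)%:Z.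
Proof. by rewrite -(residue_mod x) ltz_pmod // ltz_nat expn_gt0 p_gt0. Qed.

Lemma residue_mod_le x k l : (k <= l)%N -> (x l %% (p ^ k)%:Z)%Z = x k.
Proof.
move=> /subnK <-; elim: (l - k)%N => [|a IHa]; first by rewrite residue_mod.
rewrite addSn -IHa -(residue_coherent x (a + k)).
rewrite [in LHS](divz_eq (x (a + k).+1) (p ^ (a + k))%:Z).
by rewrite [in X in _ * X + _]expnD PoszM mulrA modzMDl.
Qed.

Fact div_pow_subproof x k : x k = 0 ->
  forall j, ((x (j.+1 + k)%N %/ (p ^ k)%:Z)%Z
             = (x (j + k)%N %/ (p ^ k)%:Z)%Z %[mod (p ^ j)%:Z])%Z.
Proof.
move=> xk j.
have pk0 := pow_neq0 k.
have dv i : x (i + k)%N = (x (i + k)%N %/ (p ^ k)%:Z)%Z * (p ^ k)%:Z.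
  by rewrite divzK //; apply/dvdz_mod0P; rewrite residue_mod_le // leq_addl.
have [z E] : exists z, x (j.+1 + k)%N - x (j + k)%N = z * (p ^ (j + k))%:Z.
  by apply/dvdzP; rewrite -eqz_mod_dvd addSn residue_coherent residue_mod.
apply/eqP; rewrite eqz_mod_dvd; apply/dvdzP; exists z; apply: (mulIf pk0).
by rewrite mulrBl -!dv E expnD PoszM mulrA.
Qed.

(** The quotient has [x (j + k) / p^k] as its residue at level [j]; the division is exact because
    [x (j + k)] reduces to [x k = 0] modulo [p ^ k]. *)
Lemma padic_div_pow x k : x k = 0 -> exists y, x = y *+ (p ^ k).
Proof.
move=> xk; exists (padic_of_seq (div_pow_subproof xk)).
apply: padic_int_ext => j; rewrite residueMn /=.
rewrite -mulr_natr natz modzMml divzK; last first.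
  by apply/dvdz_mod0P; rewrite residue_mod_le // leq_addl.
by rewrite residue_mod_le // leq_addr.
Qed.

End PadicArithmetic.

(** * Nakayama's lemma over the p-adic integers *)

Section Nakayama.
Variables (p n : nat).
Hypothesis p_gt0 : (0 < p)%N.
Local Notation Zp := (padic_int p).

Lemma padic_mx_div_pow r (M : 'M[Zp]_(n, r)) k : (forall i j, (M i j) k = 0) ->
  exists M', M = M' *+ (p ^ k).
Proof.
move=> Mk; have dv i j := cid (padic_div_pow p_gt0 (Mk i j)).
exists (\matrix_(i, j) projT1 (dv i j)); apply/matrixP => i j.
by rewrite mulmxnE mxE; case: (dv i j).
Qed.

(* The inverse is the p-adic limit of the partial sums of the geometric series. *)
Lemma padic_mx_geometric (B : 'M[Zp]_n) : exists C, (1%:M - B *+ p) *m C = 1%:M.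
Proof.
pose G k : 'M[Zp]_n := \sum_(i < k) (B *+ p) ^+ i.
have GS k : G k.+1 = G k + B ^+ k *+ (p ^ k).
  by rewrite /G big_ord_recr /= exprMn_n.
have hG i j k : ((G k.+1 i j) k.+1 = (G k i j) k %[mod (p ^ k)%:Z])%Z.
  rewrite residue_coherent residue_mod GS mxE mulmxnE residueD residue_pow.
  by rewrite addr0 residue_mod.
pose C : 'M[Zp]_n := \matrix_(i, j) padic_of_seq (hG i j).
exists C; apply/eqP; rewrite -subr_eq0; apply/eqP/matrixP => i j.
apply: padic_int_ext => k.
have [D CD] : exists D, C - G k = D *+ (p ^ k).
  apply: padic_mx_div_pow => a b; rewrite !mxE residueD.
  rewrite -[X in ((X + _) %% _)%Z]/((G k a b k %% (p ^ k)%:Z)%Z) residue_mod.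
  by rewrite -residueD subrr residue0.
(* Replacing [C] by its partial sum [G k] costs a multiple of [p ^ k], and the product with [G k]
   telescopes to [1 - (pB)^k]. Hence the residue at level [k] vanishes. *)
have -> : (1%:M - B *+ p) *m C - 1%:M = ((1%:M - B *+ p) *m D - B ^+ k) *+ (p ^ k).
  have -> : C = G k + D *+ (p ^ k) by rewrite -CD addrC subrK.
  have GX : (1%:M - B *+ p) *m G k = 1%:M - (B *+ p) ^+ k.
    have E : (B *+ p) ^+ k - 1%:M = (B *+ p - 1%:M) *m G k := subrX1 _ _.
    by rewrite -[LHS]opprK -mulNmx opprB -E opprB.
  rewrite mulmxDr GX exprMn_n mulrnBl.
  have -> : (1%:M - B *+ p) *m (D *+ p ^ k) = (1%:M - B *+ p) *m D *+ p ^ k.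
    by rewrite raddfMn.
  by rewrite addrAC [X in X + _]addrAC subrr add0r addrC.
by rewrite mulmxnE residue_pow mxE residue0.
Qed.

(** On basis vectors the hypothesis reads [p^k = X A + p^(k+1) B], that is [X A = p^k (1 - p B)]. A
    right inverse [C] of [1 - p B] gives [p^k v = X (A C v)]. *)
Lemma padic_nakayama (X : 'M[Zp]_n) k :
    (forall v : 'cV[Zp]_n, exists u w, v *+ (p ^ k) = X *m u + w *+ (p ^ k.+1)) ->
  forall v : 'cV[Zp]_n, exists u, v *+ (p ^ k) = X *m u.
Proof.
move=> hX v.
have hX' (j : 'I_n) : exists uw : 'cV[Zp]_n * 'cV[Zp]_n,
    (delta_mx j ord0 : 'cV[Zp]_n) *+ (p ^ k) = X *m uw.1 + uw.2 *+ (p ^ k.+1).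
  by have [u [w E]] := hX (delta_mx j ord0); exists (u, w).
pose uw j := projT1 (cid (hX' j)).
pose A : 'M[Zp]_n := \matrix_(i, j) (uw j).1 i ord0.
pose B : 'M[Zp]_n := \matrix_(i, j) (uw j).2 i ord0.
have XAB : 1%:M *+ (p ^ k) = X *m A + B *+ (p ^ k.+1).
  apply/matrixP => i j; have := congr1 (fun M : 'cV_n => M i ord0) (projT2 (cid (hX' j))).
  rewrite -/(uw j) !mulmxnE !mxE !mulmxnE !mxE eqxx andbT => ->.
  by congr (_ + _); apply: eq_bigr => l _; rewrite !mxE.
have [C BC] := padic_mx_geometric B.
exists (A *m C *m v).
have XA : X *m A = (p ^ k)%:R *: (1%:M - B *+ p).
  by rewrite scaler_nat mulrnBl XAB -mulrnA -expnS addrK.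
by rewrite !mulmxA XA -!scalemxAl BC mul1mx scaler_nat.
Qed.

End Nakayama.

(** * Cokernels modulo a power of p *)

Section Reduction.
Variables (p m n : nat).
Hypothesis p_pr : prime p.
Local Notation Zp := (padic_int p).
Local Notation q := (p ^ m.+1)%N.
Local Notation U := 'cV['Z_q]_n.

Definition red (x : Zp) : 'Z_q := (x m.+1)%:~R.

Let q1 : (1 < q)%N := expS_prime_gt1 m p_pr.
Let p0 : (0 < p)%N := prime_gt0 p_pr.

Lemma intr_modZp (a : int) : (a %% q%:Z)%Z%:~R = a%:~R :> 'Z_q.
Proof.
transitivity (((a %/ q%:Z)%Z * q%:Z + (a %% q%:Z)%Z)%:~R : 'Z_q).
  rewrite [RHS]intrD [X in _ = X + _]intrM -[q%:Z%:~R]/(q%:R) pchar_Zp //.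
  by rewrite mulr0 add0r.
by rewrite -divz_eq.
Qed.

Lemma val_red x : (red x : nat)%:Z = x m.+1.
Proof.
have := residue_lt p0 x m.+1; have := residue_ge0 p0 x m.+1.
rewrite /red; case: (x m.+1) => // a _ aq.
by rewrite -[a%:Z%:~R]/(a%:R) val_Zp_nat // modn_small.
Qed.

Lemma redD x y : red (x + y) = red x + red y.
Proof. by rewrite /red residueD intr_modZp intrD. Qed.

Lemma red0 : red 0 = 0.
Proof. by rewrite /red residue0. Qed.

Lemma redMn x a : red (x *+ a) = red x *+ a.
Proof. by rewrite /red residueMn intr_modZp rmorphMn. Qed.

Lemma redM x y : red (x * y) = red x *+ red y.
Proof.
by rewrite /red residueM intr_modZp intrM -[in LHS](val_red y) -mulr_natr.
Qed.

Lemma red_nat (z : 'Z_q) : red (z : nat)%:R = z.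
Proof.
by rewrite /red residueMn -mulr_natr natz intr_modZp intrM intr_modZp mul1r -[RHS]natr_Zp.
Qed.

Lemma red_eq x y : red x = red y -> exists z, x = y + z *+ q.
Proof.
move=> xy; have /(padic_div_pow p0) [z xyz] : (x - y) m.+1 = 0.
  have : x m.+1 = y m.+1 by rewrite -!val_red xy.
  by move=> e; rewrite residueD e -residueD subrr residue0.
by exists z; rewrite -xyz addrC subrK.
Qed.

Definition redv (v : 'cV[Zp]_n) : U := map_mx red v.

Lemma redvD u v : redv (u + v) = redv u + redv v.
Proof. by apply/colP => i; rewrite !mxE redD. Qed.

Lemma redv_eq u v : redv u = redv v -> exists w, u = v + w *+ q.
Proof.
move=> uv; have E i : exists z, u i ord0 = v i ord0 + z *+ q.
  by apply: red_eq; have := congr1 (fun M : U => M i ord0) uv; rewrite !mxE.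
exists (\col_i projT1 (cid (E i))); apply/colP => i.
by rewrite !mxE mulmxnE mxE -(projT2 (cid (E i))).
Qed.

Definition liftv (a : U) : 'cV[Zp]_n := map_mx (fun z : 'Z_q => (z : nat)%:R) a.

Lemma liftvK a : redv (liftv a) = a.
Proof. by apply/colP => i; rewrite !mxE red_nat. Qed.

Definition redcols (X : 'M[Zp]_n) : {ffun 'I_n -> U} :=
  [ffun j => col j (map_mx red X)].

Lemma redv_mul X u : redv (X *m u) = \sum_j redcols X j *+ red (u j ord0).
Proof.
apply/colP => i; rewrite !mxE summxE (big_morph red redD red0).
by apply: eq_bigr => j _; rewrite redM mulmxnE ffunE !mxE.
Qed.

(** Scalars of ['Z_q] act as natural multiples, so the subgroup generated by the reduced columns is
    their whole span, the reduction of the image of [X]. *)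
Lemma redcols_span X (a : U) :
  a \in <<redcols X @: [set: 'I_n]%SET>>%g <-> exists u, a = redv (X *m u).
Proof.
pose A : {set U} := [set a | `[< exists u, a = redv (X *m u) >]]%SET.
have AP b : reflect (exists u, b = redv (X *m u)) (b \in A).
  by rewrite inE; apply: asboolP.
have gA : group_set A.
  apply/group_setP; split.
    apply/AP; exists 0; rewrite mulmx0; apply/colP => i.
    by rewrite !mxE red0.
  move=> b c /AP[u ->] /AP[v ->]; apply/AP; exists (u + v).
  by rewrite mulmxDr redvD.
split=> [aX|[u ->]].
  have sA : (<<redcols X @: [set: 'I_n]%SET>> \subset Group gA)%g.
    rewrite gen_subG; apply/fintype.subsetP => _ /imsetP[j _ ->]; apply/AP.
    by exists (delta_mx j ord0); apply/colP => i; rewrite ffunE -colE !mxE.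
  by apply/AP; apply: (fintype.subsetP sA).
rewrite redv_mul; elim/big_ind: _ => [|b c bX cX|j _].
- exact: (group1 <<_>>).
- exact: (groupM bX cX).
- by rewrite -FinRing.zmodXgE; apply: groupX; rewrite mem_gen ?imset_f.
Qed.

End Reduction.

(** * Recognising the cokernel from the columns modulo p^(m+1) *)

Section CokernelReduction.
Variables (p m n : nat) (gT : finGroupType) (H : {group gT}).
Hypotheses (p_pr : prime p) (abH : abelian H) (cardH : #|H| = (p ^ m)%N).
Local Notation Zp := (padic_int p).
Local Notation q := (p ^ m.+1)%N.
Local Notation U := 'cV['Z_q]_n.
Local Notation V := 'cV[Zp]_n.
Variable X : 'M[Zp]_n.

Let q1 : (1 < q)%N := expS_prime_gt1 m p_pr.
Let p0 : (0 < p)%N := prime_gt0 p_pr.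
Let Hpm x : x \in H -> (x ^+ (p ^ m) = 1)%g.
Proof. by move=> Hx; rewrite -cardH expg_cardG. Qed.
Let Hq x : x \in H -> (x ^+ q = 1)%g.
Proof. exact: exp_q. Qed.

(** An isomorphism from the cokernel to [H], pulled back to a map on column vectors so that no
    quotient type appears. *)
Definition cok_morphism (g : V -> gT) :=
  [/\ {morph g : x y / x + y >-> (x * y)%g},
      forall v, g v = 1%g <-> exists u, v = X *m u & range g = [set` H]].

Lemma morph0 (g : V -> gT) : {morph g : x y / x + y >-> (x * y)%g} -> g 0 = 1%g.
Proof. by move=> gD; apply: (mulgI (g 0)); rewrite -gD mulg1 addr0. Qed.

Lemma morphMn (g : V -> gT) v a : {morph g : x y / x + y >-> (x * y)%g} ->
  g (v *+ a) = (g v ^+ a)%g.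
Proof.
move=> gD; elim: a => [|a IHa]; first by rewrite mulr0n morph0.
by rewrite mulrS gD IHa expgS.
Qed.

Lemma isog_cokP : isog_zmod (cok X) H <-> exists g, cok_morphism g.
Proof.
have piP (u v : V) : \pi_(cok X)%qT u = \pi_(cok X)%qT v <-> exists w, u - v = X *m w.
  split=> [/eqP|[w uvw]].
    by rewrite -Quotient.idealrBE => /asboolP.
  by apply/eqP; rewrite -Quotient.idealrBE; apply/asboolP; exists w.
split=> [[f [fD f_inj fH]]|[g [gD gK gH]]].
  exists (fun v => f (\pi_(cok X)%qT v)); split.
  - by move=> u v; rewrite -fD; congr f; rewrite !piE.
  - move=> v; have f0 : f 0 = 1%g by apply: (mulgI (f 0)); rewrite -fD mulg1 addr0.
    have pi0 : 0 = \pi_(cok X)%qT 0 :> cok X by rewrite piE.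
    rewrite -f0 pi0; split=> [/f_inj/piP|vX]; first by rewrite subr0.
    by congr f; apply/piP; rewrite subr0.
  - rewrite -fH; apply/seteqP; split=> _ [x _ <-]; first by exists (\pi_(cok X)%qT x).
    by exists (generic_quotient.repr x) => //; rewrite reprK.
have g_pi u v : \pi_(cok X)%qT u = \pi_(cok X)%qT v <-> g u = g v.
  rewrite piP; rewrite -gK; split=> [guv|guv].
    by rewrite -[u](subrK v) gD guv mul1g.
  by apply: (mulIg (g v)); rewrite -gD subrK mul1g.
exists (fun x => g (generic_quotient.repr x)); split.
- by move=> x y; rewrite -gD; apply/g_pi; rewrite reprK -{1}[x]reprK -{1}[y]reprK !piE.
- by move=> x y /g_pi; rewrite !reprK.
- rewrite -gH; apply/seteqP; split=> _ [x _ <-]; first by exists (generic_quotient.repr x).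
  by exists (\pi_(cok X)%qT x) => //; apply/g_pi; rewrite reprK.
Qed.

(** A vector equals the combination of basis vectors given by its reduction up to a multiple of [q],
    and [q] kills [H]. *)
Lemma morph_ev (g : V -> gT) v : {morph g : x y / x + y >-> (x * y)%g} ->
    (forall v, g v \in H) ->
  g v = ev [ffun i => g (delta_mx i ord0)] (redv m v).
Proof.
move=> gD gH.
have [w vE] : exists w, v = \sum_i delta_mx i ord0 *+ red m (v i ord0) + w *+ q.
  apply: redv_eq => //; apply/colP => i; rewrite !mxE summxE.
  rewrite (bigD1 i) //= big1 ?addr0 => [|j /negbTE ji].
    by rewrite mulmxnE mxE !eqxx /= red_nat.
  by rewrite mulmxnE mxE eq_sym ji /= mul0rn.
rewrite [in LHS]vE gD morphMn // Hq // mulg1 (big_morph g gD (morph0 gD)) /ev.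
by apply: eq_bigr => i _; rewrite morphMn // ffunE mxE.
Qed.

(** Forwards, [h] records the images of the basis vectors. Backwards, [ev h] after reduction has
    kernel [im X + q V], and Nakayama's lemma absorbs [q V] into [im X]. *)
Lemma isog_cok_presented :
  isog_zmod (cok X) H <->
  exists h, presents H n (redcols m X) h.
Proof.
rewrite isog_cokP; split=> [[g [gD gK gH]]|[h /andP[gh /eqP ck]]].
  have gHv v : g v \in H.
    by have : [set` H] (g v) by rewrite -gH; exists v.
  have gE v := morph_ev v gD gHv.
  set h := [ffun i => g (delta_mx i ord0)] in gE.
  have hH i : h i \in H by rewrite ffunE.
  exists h; apply/andP; split.
    apply/andP; split; first exact/forallP.
    rewrite finset.eqEsubset prefix_gen_sub //=; apply/fintype.subsetP => x Hx.
    have [v _ <-] : range g x by rewrite gH.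
    rewrite gE -(ev_supp q1 abH Hq hH) supp_full //.
    by apply: (mem_morphim (ev_morphism q1 abH Hq hH)); rewrite inE.
  apply/eqP/finset.setP => a; rewrite [RHS]inE; apply/idP/eqP.
    by case/(redcols_span p_pr) => u ->; rewrite -gE; apply/gK; exists u.
  rewrite -(liftvK p_pr a) -gE => /gK[u ->].
  by apply/(redcols_span p_pr); exists u.
have /andP[/forallP hH _] := gh.
pose g (v : V) := ev h (redv m v).
have gD : {morph g : x y / x + y >-> (x * y)%g}.
  by move=> u v; rewrite /g redvD // -FinRing.zmodMgE (evM q1 abH Hq hH) ?inE.
have gHv v : g v \in H by apply: (ev_in hH).
have gspan v : g v = 1%g <-> exists u, redv m v = redv m (X *m u).
  by rewrite -(redcols_span p_pr) ck inE; split=> /eqP.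
have gX u : g (X *m u) = 1%g by apply/gspan; exists u.
(* As [p ^ m] kills [H], the vector [p^m v] lies in [im X + p^(m+1) V], which is the hypothesis of
   [padic_nakayama] at [k = m]. *)
have nak : forall v : V, exists u, v *+ (p ^ m) = X *m u.
  apply: (padic_nakayama p0) => v.
  have /gspan[u /(redv_eq p_pr)[w E]] : g (v *+ p ^ m) = 1%g.
    by rewrite morphMn // Hpm.
  by exists u, w.
exists g; split=> //.
  move=> v; split=> [/gspan[u /(redv_eq p_pr)[w ->]]|[u ->]] //.
  have [u' E] := nak (w *+ p); exists (u + u').
  by rewrite mulmxDr -E -mulrnA -expnS.
apply/seteqP; split=> [_ [v _ <-]|x Hx]; first exact: gHv.
have [a ->] := ev_onto q1 abH Hq gh Hx.
by exists (liftv a) => //; rewrite /g liftvK.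
Qed.

End CokernelReduction.

(** * Distribution of the reduced matrix *)

Section HaarResidue.
Variables (p m : nat).
Hypothesis p_pr : prime p.
Local Notation q := (p ^ m.+1)%N.

Let q1 : (1 < q)%N := expS_prime_gt1 m p_pr.

Definition red_fiber (z : 'Z_q) : set (padic_borel p) :=
  [set x | red m (x : padic_int p) = z].

Lemma measurable_red_fiber z : measurable (red_fiber z).
Proof.
apply: sub_sigma_algebra; suff: @padic_open p (red_fiber z) by [].
move=> x xz; exists m.+1 => y /= yx.
by rewrite -xz /red_fiber /red /= yx.
Qed.

Lemma measure_finset_bigcup d (T : measurableType d) (R : realType)
    (mu : {measure set T -> \bar R}) (I : finType) (A : {set I}) (F : I -> set T) :
    (forall i, measurable (F i)) -> trivIset setT F ->
  mu (\bigcup_(i in [set` A]) F i) = (\sum_(i in A) mu (F i))%E.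
Proof.
move=> mF tF; rewrite measure_fin_bigcup //.
- transitivity (\sum_(i \in [set` enum A]) mu (F i))%E.
    by apply: eq_fsbigl; apply/seteqP; split=> i /=; rewrite mem_enum.
  by rewrite -fsbig_seq ?enum_uniq // big_enum.
- exact: sub_trivIset tF.
Qed.

(** The [q] fibers partition the space and are translates of one another, hence equally likely. *)
Lemma haar_red_fiber d (T : measurableType d) (R : realType) (P : probability T R)
    (Y : T -> padic_borel p) (z : 'Z_q) :
  haar_distributed P Y -> P (Y @^-1` red_fiber z) = (q%:R^-1)%:E.
Proof.
move=> [mY [_ PY]].
have mF z' : measurable (Y @^-1` red_fiber z').
  by rewrite -[X in measurable X]setTI; apply: mY => //; apply: measurable_red_fiber.
have Pz z' : P (Y @^-1` red_fiber z') = P (Y @^-1` red_fiber 0).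
  have := PY (z' : nat)%:R (red_fiber 0) (measurable_red_fiber 0).
  rewrite /pushforward => <-; congr (P (_ @^-1` _)); apply/seteqP; split=> x /=.
    move=> xz; exists ((x : padic_int p) - (z' : nat)%:R); last by rewrite addrC subrK.
    have : red m ((x : padic_int p) - (z' : nat)%:R + (z' : nat)%:R) = z'.
      by rewrite subrK; exact: xz.
    by rewrite redD // red_nat // => /(canRL (addrK _)); rewrite subrr.
  by case=> y y0 <-; rewrite /red_fiber /= redD // y0 addr0 red_nat.
have : P setT = (\sum_(z' in [set: 'Z_q]%SET) P (Y @^-1` red_fiber z'))%E.
  rewrite -measure_finset_bigcup //; last first.
    by apply/trivIsetP => i j _ _ ij; apply/seteqP; split=> // w [wi wj];
       move/negP: ij; apply; apply/eqP; rewrite -wj; exact/esym.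
  congr (P _); apply/seteqP; split=> // w _.
  by exists (red m (Y w : padic_int p)) => //=; rewrite inE.
rewrite probability_setT (eq_bigr (fun=> P (Y @^-1` red_fiber 0))); last by move=> i _; rewrite Pz.
rewrite -(Pz z).
have /fineK <- : P (Y @^-1` red_fiber z) \is a fin_num by exact: fin_num_measure.
rewrite sumEFin sumr_const cardsT card_ord Zp_cast // => -[E].
congr (_%:E); apply: (mulfI (x := q%:R)).
  by rewrite pnatr_eq0 -lt0n ltnW.
by rewrite divff ?pnatr_eq0 -?lt0n 1?ltnW // mulr_natl -E.
Qed.

End HaarResidue.

Section StaircaseDistribution.
Variables (p m n t : nat).
Hypotheses (p_pr : prime p) (tn : (t <= n)%N).
Local Notation q := (p ^ m.+1)%N.
Local Notation U := 'cV['Z_q]_n.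
Local Notation W := (\prod_(j < n) #|supp q n (t + j)|)%N.
Variables (d : measure_display) (T : measurableType d) (R : realType).
Variables (P : probability T R) (X : T -> 'M[padic_int p]_n).
Hypothesis XP : haar_random_supported P (@staircase t n) X.

Let q1 : (1 < q)%N := expS_prime_gt1 m p_pr.
Let J := [set ij : 'I_n * 'I_n | ij.1 \in staircase t ij.2]%SET.
Let entry (ij : 'I_n * 'I_n) (w : T) : padic_borel p := X w ij.1 ij.2.

(** The full columns need no separate case: for [j >= n - t] the bound [t + j] is at least [n]. *)
Lemma mem_staircase (i j : 'I_n) : (i \in staircase t j) = (i < t + j)%N.
Proof.
rewrite /staircase; case: ltnP => jn; first by rewrite inE.
by rewrite inE; apply/esym; have := ltn_ord i; lia.
Qed.

Lemma prod_staircase (r : R) :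
  \prod_(ij in J) r = \prod_(j < n) r ^+ minn (t + j) n.
Proof.
rewrite (eq_bigl (fun ij : 'I_n * 'I_n => ij.1 < t + ij.2)%N); last first.
  by move=> ij; rewrite inE mem_staircase.
rewrite (reindex (fun ij : 'I_n * 'I_n => (ij.2, ij.1))) /=; last first.
  by exists (fun ij : 'I_n * 'I_n => (ij.2, ij.1)) => -[].
rewrite -(pair_big_dep predT (fun j i : 'I_n => i < t + j)%N (fun _ _ => r)) /=.
apply: eq_bigr => j _; rewrite prodr_const; congr (_ ^+ _).
by rewrite -(card_ord_lt n (t + j)); apply: eq_card.
Qed.

Lemma redcols_supported w : stair_supported t (redcols m (X w)).
Proof.
case: XP => X0 _ _; apply/forallP => j; apply/suppP => i ij.
by rewrite ffunE !mxE X0 ?red0 // mem_staircase -leqNgt.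
Qed.

Let E_ (c : {ffun 'I_n -> U}) := [set w | redcols m (X w) = c].

(** Entries off the staircase vanish on both sides, so the event only involves the independent
    entries. *)
Lemma redcols_event (c : {ffun 'I_n -> U}) : stair_supported t c ->
  E_ c = \bigcap_(ij in [set` J]) (entry ij @^-1` red_fiber (c ij.2 ij.1 ord0)).
Proof.
move=> /forallP cS; apply/seteqP; split=> w.
  by move=> /= <- [i j] _; rewrite /= ffunE !mxE.
move=> wJ; apply/ffunP => j; apply/colP => i; rewrite ffunE !mxE.
have [ij|ij] := boolP (i \in staircase t j).
  by apply: (wJ (i, j)); rewrite /= inE.
case: XP => X0 _ _; rewrite X0 // red0; move: ij; rewrite mem_staircase -leqNgt => ij.
by have /suppP/(_ i ij) -> := cS j.
Qed.

Lemma measurable_redcols c : measurable (E_ c).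
Proof.
have [cS|ncS] := boolP (stair_supported t c); last first.
  rewrite (_ : E_ c = set0); first exact: measurable0.
  apply/seteqP; split=> // w /= wc; move: ncS.
  by rewrite -wc redcols_supported.
rewrite redcols_event //; apply: fin_bigcap_measurable => // -[i j] /=.
rewrite inE => ij; case: XP => _ /(_ _ _ ij)[mY _] _.
rewrite -[X in measurable X]setTI; apply: mY => //; exact: measurable_red_fiber.
Qed.

Lemma prob_redcols c : stair_supported t c -> P (E_ c) = (W%:R^-1)%:E.
Proof.
move=> cS; rewrite redcols_event //; case: XP => _ XH XI.
rewrite (XI J (fun ij => red_fiber (c ij.2 ij.1 ord0))) //; last first.
  by move=> ij; apply: measurable_red_fiber.
rewrite (eq_bigr (fun=> (q%:R^-1)%:E)); last first.
  by move=> ij; rewrite inE => ijS; apply: haar_red_fiber => //; apply: XH.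
rewrite prodEFin prod_staircase; congr (_%:E).
rewrite natr_prod -prodfV; apply: eq_bigr => j _.
by rewrite card_supp // [in RHS]natrX exprVn.
Qed.

Variables (gT : finGroupType) (H : {group gT}).
Hypotheses (abH : abelian H) (cardH : #|H| = (p ^ m)%N).

Lemma prob_cok_isog :
  P [set w | isog_zmod (cok (X w)) H]
  = (#|presented p m n t H n|%:R / W%:R)%:E.
Proof.
rewrite (_ : [set w | _] = \bigcup_(c in [set` presented p m n t H n]) E_ c).
  rewrite measure_finset_bigcup; first last.
  - apply/trivIsetP => c c' _ _ cc'; apply/seteqP; split=> // w [/= wc wc'].
    by move: cc'; rewrite -wc -wc' eqxx.
  - exact: measurable_redcols.
  rewrite (eq_bigr (fun=> (W%:R^-1)%:E)); last first.
    by move=> c; rewrite inE => /andP[cS _]; apply: prob_redcols.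
  by rewrite sumEFin sumr_const mulr_natl.
apply/seteqP; split=> w /=.
  move=> /(isog_cok_presented p_pr abH cardH) [h wh]; exists (redcols m (X w)) => //=.
  by rewrite inE redcols_supported; apply/existsP; exists h.
case=> c /=; rewrite inE => /andP[_ /existsP[h ch]] wc.
by apply/(isog_cok_presented p_pr abH cardH); exists h; rewrite wc.
Qed.

End StaircaseDistribution.

(** * Limits *)

Section EulerProduct.
Variables (R : realType) (p : nat).
Hypothesis p_pr : prime p.

Definition euler_factor (i : nat) : R := 1 - p%:R ^- i.
Definition euler_prod (N : nat) : R := \prod_(1 <= i < N.+1) euler_factor i.

Lemma invp_itv i : 0 <= (p%:R ^- i : R) <= 1.
Proof.
rewrite invr_ge0 exprn_ge0 //= invf_le1 ?exprn_gt0 ?ltr0n ?prime_gt0 //.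
by rewrite exprn_ege1 // ler1n prime_gt0.
Qed.

Lemma euler_factor_itv i : 0 <= euler_factor i <= 1.
Proof. by have /andP[] := invp_itv i; rewrite /euler_factor; lra. Qed.

Lemma euler_prod_itv N : 0 <= euler_prod N <= 1.
Proof.
rewrite prodr_ge0 => [|i _]; last by have /andP[] := euler_factor_itv i.
by apply: prodr_ile1 => i _; apply: euler_factor_itv.
Qed.

Lemma cvg_euler_prod : euler_prod N @[N --> \oo] --> infinite_prod euler_factor.
Proof.
apply: nonincreasing_is_cvgn; last first.
  by exists 0 => _ [N _ <-]; have /andP[] := euler_prod_itv N.
apply/nonincreasing_seqP => N; rewrite /euler_prod [leLHS]big_nat_recr //=.
have /andP[P0 _] := euler_prod_itv N; have /andP[_ f1] := euler_factor_itv N.+1.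
by rewrite ler_piMr.
Qed.

(** For [j < n - t] the minimum is [t + j] and the factor is [1 - p^-t]; for the last [t] columns it
    is [n], and [n - j] runs through [1, ..., t] backwards. *)
Lemma flag_prob_euler n t : (t <= n)%N ->
  flag_prob p n t R = euler_factor t ^+ (n - t) * euler_prod t.
Proof.
move=> tn; rewrite /flag_prob.
rewrite -(big_mkord xpredT (fun j => 1 - p%:R ^+ j / p%:R ^+ minn (t + j) n : R)).
rewrite (@big_cat_nat _ _ _ (n - t)) ?leq_subr //=; congr (_ * _).
  rewrite big_nat (eq_bigr (fun=> euler_factor t)) -?big_nat ?prodr_const_nat ?subn0 //.
  move=> j /andP[_ jnt]; rewrite /euler_factor; congr (1 - _).
  have -> : minn (t + j) n = (t + j)%N by apply/minn_idPl; lia.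
  have p0 : p%:R ^+ j != 0 :> R by rewrite expf_neq0 // pnatr_eq0 -lt0n prime_gt0.
  by rewrite exprD invfM mulrCA divff // mulr1.
rewrite -{1}[(n - t)%N]add0n big_addn subKn // big_nat_rev /= /euler_prod.
rewrite big_add1 /= big_nat [RHS]big_nat; apply: eq_bigr => j /andP[_ jt].
rewrite /euler_factor; congr (1 - _).
(* After shifting and reversing, the column index is [n - j.+1], at distance [j.+1] from [n]. *)
have -> : minn (t + (0 + t - j.+1 + (n - t))) n = (j.+1 + (0 + t - j.+1 + (n - t)))%N.
  by lia.
rewrite [X in _ / X]exprD invfM mulrCA divff ?mulr1 //.
by rewrite expf_neq0 // pnatr_eq0 -lt0n prime_gt0.
Qed.

Lemma bernoulli_ineq (x : R) k : 0 <= x <= 1 -> 1 - k%:R * x <= (1 - x) ^+ k.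
Proof.
move=> /andP[x0 x1]; elim: k => [|k IHk]; first by rewrite mul0r subr0 expr0.
rewrite exprSr; apply: le_trans (ler_wpM2r _ IHk); last by lra.
by rewrite -natr1; have := ler0n R k; nra.
Qed.

(** Bernoulli's inequality bounds [(1 - p^-t)^(n - t)] below by [1 - n p^-t]. *)
Lemma flag_prob_bounds n t : (t <= n)%N ->
  (1 - n%:R / p%:R ^+ t) * euler_prod t <= flag_prob p n t R <= euler_prod t.
Proof.
move=> tn; rewrite flag_prob_euler //.
have /andP[P0 _] := euler_prod_itv t; have ft := euler_factor_itv t.
have /andP[f0 f1] := ft; have it := invp_itv t; have /andP[i0 i1] := it.
rewrite ler_wpM2r //=; last first.
  apply: le_trans (bernoulli_ineq _ it); rewrite lerD2l lerN2 ler_wpM2r //.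
  by rewrite ler_nat leq_subr.
by rewrite ler_piMl // exprn_ile1.
Qed.

End EulerProduct.

(** * Consequences of the growth hypothesis *)

Section Growth.
Variables (R : realType) (p : nat) (t : nat -> nat).
Hypothesis p_pr : prime p.
Hypothesis t_growth :
  ((t n)%:R - log_base p%:R n%:R : R) @[n --> \oo] --> +oo.

Let lnp_gt0 : 0 < ln (p%:R : R).
Proof. by rewrite ln_gt0 // ltr1n prime_gt1. Qed.

(** For [n >= 1] the logarithm is nonnegative, so [t n] dominates [t n - log_p n]. *)
Lemma growth_infty : t n @[n --> \oo] --> \oo.
Proof.
apply/(@cvgrnyP R); apply: ger_cvgy t_growth; near=> n.
rewrite gerBl /log_base divr_ge0 ?(ltW lnp_gt0) // ln_ge0 // ler1n.
by near: n; exists 1%N.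
Unshelve. all: by end_near. Qed.

(** For [n >= 1] the ratio is the exponential of [- ln p (t n - log_p n)]. *)
Lemma growth_ratio : (n%:R / p%:R ^+ t n : R) @[n --> \oo] --> 0.
Proof.
have lim : expR (- (ln p%:R * ((t n)%:R - log_base p%:R n%:R))) @[n --> \oo] --> (0 : R).
  apply: (cvg_comp _ _ _ (@cvgr_expR R)).
  apply: (cvg_comp _ _ t_growth); apply: gt0_cvgMry lnp_gt0 _.
  exact: cvg_id.
apply: cvg_trans lim; apply: near_eq_cvg; near=> n.
have n0 : 0 < n%:R :> R by rewrite ltr0n; near: n; exists 1%N.
rewrite /log_base mulrBr mulrCA divff ?gt_eqF // mulr1 opprB expRD lnK ?posrE //.
by rewrite expRN [ln _ * _]mulrC expRM_natl lnK // posrE ltr0n prime_gt0.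
Unshelve. all: by end_near. Qed.

End Growth.

Section Limit.
Variables (R : realType) (p : nat) (t : nat -> nat).
Hypothesis p_pr : prime p.
Hypothesis t_bounds : forall n, (1 <= n)%N -> (1 <= t n <= n)%N.
Hypothesis t_growth :
  ((t n)%:R - log_base p%:R n%:R : R) @[n --> \oo] --> +oo.

Lemma near_t_le : \forall n \near \oo, (t n <= n)%N.
Proof. by exists 1%N => // n /t_bounds/andP[]. Qed.

Lemma cvg_flag_prob :
  flag_prob p n (t n) R @[n --> \oo] --> infinite_prod (euler_factor R p).
Proof.
have cE : euler_prod R p (t n) @[n --> \oo] --> infinite_prod (euler_factor R p).
  apply: (@cvg_comp _ _ _ t (euler_prod R p)); last exact: cvg_euler_prod.
  exact: (growth_infty p_pr t_growth).
apply: (squeeze_cvgr _ _ cE); last first.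
  rewrite -[X in _ --> X]mul1r; apply: cvgM cE.
  rewrite -[X in _ --> X]subr0; apply: cvgB; first exact: cvg_cst.
  exact: (growth_ratio p_pr t_growth).
by near=> n; apply: flag_prob_bounds => //; near: n; apply: near_t_le.
Unshelve. all: by end_near. Qed.

Lemma cvg_gen_ratio (gT : finGroupType) (H : {group gT}) :
  gen_ratio n H R (t n) @[n --> \oo] --> (1 : R).
Proof.
apply: (squeeze_cvgr _ _ (cvg_cst (1 : R))); last first.
  rewrite -[X in _ --> X]subr0; apply: cvgB; first exact: cvg_cst.
  rewrite -[X in _ --> X](mulr0 #|{: {group gT}}|%:R); apply: cvgM; first exact: cvg_cst.
  apply: (@cvg_comp _ _ _ t (fun k => (2 ^+ k)^-1 : R)).
    exact: (growth_infty p_pr t_growth).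
  rewrite (_ : (fun k => _) = (fun k => 2^-1 ^+ k : R)).
    by apply: cvg_expr; rewrite ger0_norm ?invr_ge0 // invf_lt1 // ltr1n.
  by apply/funext => k; rewrite exprVn.
by near=> n; apply: gen_ratio_bounds => //; near: n; apply: near_t_le.
Unshelve. all: by end_near. Qed.

(** By [presented_estimate] the ratio lies between [main n - err n] and [main n + err n]; the error
    is a constant times [n / p^(t n)]. *)
Lemma cvg_presented_ratio m (gT : finGroupType) (H : {group gT}) :
    abelian H -> #|H| = (p ^ m)%N ->
  #|presented p m n (t n) H n|%:R
    / (\prod_(j < n) #|supp (p ^ m.+1) n (t n + j)|)%:R @[n --> \oo]
  --> #|Aut H|%:R^-1 * infinite_prod (euler_factor R p).
Proof.
move=> abH cardH.
pose main n := gen_ratio n H R (t n) / #|Aut H|%:R * flag_prob p n (t n) R.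
pose err n : R := #|{: {group gT}}|%:R * (n%:R * p%:R / p%:R ^+ t n).
have cmain : main n @[n --> \oo] --> #|Aut H|%:R^-1 * infinite_prod (euler_factor R p).
  apply: cvgM cvg_flag_prob; rewrite -[X in _ --> X]mul1r.
  by apply: cvgM; [exact: cvg_gen_ratio | exact: cvg_cst].
have cerr : err n @[n --> \oo] --> 0.
  rewrite (_ : err = fun n => #|{: {group gT}}|%:R * p%:R * (n%:R / p%:R ^+ t n)).
    rewrite -[X in _ --> X](mulr0 (#|{: {group gT}}|%:R * p%:R)).
    by apply: cvgM; [exact: cvg_cst | exact: (growth_ratio p_pr t_growth)].
  by apply/funext => n; rewrite /err -!mulrA; congr (_ * _); rewrite mulrCA.
apply: (@squeeze_cvgr _ _ _ _ (fun n => main n - err n) (fun n => main n + err n)).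
- near=> n; have tn : (t n <= n)%N by near: n; apply: near_t_le.
  by rewrite -ler_distl; apply: presented_estimate.
- by rewrite -[X in _ --> X]subr0; apply: cvgB.
- by rewrite -[X in _ --> X]addr0; apply: cvgD.
Unshelve. all: by end_near. Qed.

End Limit.

Theorem theorem3p3 (R : realType) (p : nat) (p_prime : prime p)
    (t : nat -> nat) (t_bounds : forall n, (1 <= n)%N -> (1 <= t n <= n)%N)
    (d : nat -> measure_display) (T : forall n, measurableType (d n))
    (P : forall n, probability (T n) R)
    (X : forall n, T n -> 'M[padic_int p]_n)
    (X_haar : forall n, (1 <= n)%N ->
      haar_random_supported (P n) (@staircase (t n) n) (X n))
    (t_growth :
      ((t n)%:R - log_base p%:R n%:R : R) @[n --> \oo] --> +oo) :
  converges_to_CL P X.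
Proof.
move=> gT H abH pH.
have cardH := card_pgroup pH.
have lim := cvg_presented_ratio p_prime t_bounds t_growth abH cardH.
have PE : \forall n \near \oo, P n [set w | isog_zmod (cok (X n w)) H] =
    (#|presented p (logn p #|H|) n (t n) H n|%:R
      / (\prod_(j < n) #|supp (p ^ (logn p #|H|).+1) n (t n + j)|)%:R)%:E.
  (* The hypotheses on [t] and [X] start at [n = 1], which is enough for a limit. *)
  exists 1%N => // n n1; have /andP[_ tn] := t_bounds n n1.
  exact: (prob_cok_isog p_prime tn (X_haar n n1) abH cardH).
apply: cvg_EFin; first by near=> n; rewrite (near PE n).
by apply: cvg_trans lim; apply: near_eq_cvg; near=> n; rewrite /= (near PE n).
Unshelve. all: by end_near. Qed.
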